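(* Let $T\in\{\mathrm{AS},\mathrm{AA},\mathrm{SA},\mathrm{SS}\}$ and let $\Lambda$ be a superpartition of bi-degree $(n|m)$ belonging to the index set of type $T$. Suppose $\alpha$ is generic. Let $\mathcal{H}=\sum_{i=1}^N\xi_i^2$ and $\mathcal{I}=\sum_{i=1}^m\xi_i$. Then the Jack polynomial with prescribed symmetry $P^T_\Lambda(x;\alpha)$ is the unique polynomial $P$ satisfying (B1) $P=m^T_\Lambda+\sum_{\Gamma<\Lambda}c_{\Lambda,\Gamma}m^T_\Gamma$ for some $c_{\Lambda,\Gamma}\in\mathbb{C}(\alpha)$ (the sum running over superpartitions $\Gamma$ of bi-degree $(n|m)$ in the index set of type $T$); (B2) $\mathcal{H}P=d_\Lambda P$ and $\mathcal{I}P=e_\Lambda P$ for some $d_\Lambda,e_\Lambda\in\mathbb{C}(\alpha)$. Moreover the eigenvalues are $d_\Lambda=2\alpha\,\varepsilon_{\Lambda^*}(\alpha)+\alpha^2|\Lambda^*|+\frac{N(N-1)(2N-1)}{6}$ and $e_\Lambda=\sum_{s=(i,j)\in\Lambda^\circledast/\Lambda^*}\big(\alpha(j-1)-(i-1)\big)$, where for a partition $\lambda$, $\varepsilon_\lambda(\alpha)=\alpha\,b(\lambda')-b(\lambda)$, $b(\lambda)=\sum_i(i-1)\lambda_i$, $\lambda'$ is the conjugate partition, $|\lambda|=\sum_i\lambda_i$, and $\Lambda^\circledast/\Lambda^*$ is the set of cells $(i,j)$ (row $i$, column $j$) with $\Lambda^*_i<j\le\Lambda^\circledast_i$.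
   Context: Fix integers $N\ge1$, $0\le m\le N$; $I=\{1,\dots,m\}$, $J=\{m+1,\dots,N\}$, $x=(x_1,\dots,x_N)$. $K_{i,j}$ exchanges $x_i$ and $x_j$ in a function of $x$. For $K\subseteq\{1,\dots,N\}$, $S_K$ is the group of permutations of $\{1,\dots,N\}$ fixing every element outside $K$; $\mathrm{Asym}_K f=\sum_{\sigma\in S_K}\mathrm{sgn}(\sigma)f(x_{\sigma(1)},\dots,x_{\sigma(N)})$ and $\mathrm{Sym}_K f=\sum_{\sigma\in S_K}f(x_{\sigma(1)},\dots,x_{\sigma(N)})$. A composition is $\eta\in\mathbb{Z}_{\ge0}^N$, $x^\eta=\prod x_i^{\eta_i}$, $\eta^+$ its decreasing rearrangement. Partitions of equal size are compared by dominance ($\lambda\ge\mu$ iff $\sum_{i\le k}\lambda_i\ge\sum_{i\le k}\mu_i$ for all $k$). For compositions of equal degree, $\eta\succ\nu$ iff $\eta\ne\nu$ and either $\eta^+>\nu^+$, or $\eta^+=\nu^+$ and $\sum_{i\le k}\eta_i\ge\sum_{i\le k}\nu_i$ for all $k$. Cherednik operators: $\xi_j=\alpha x_j\partial_{x_j}+\sum_{i<j}\frac{x_j}{x_j-x_i}(1-K_{i,j})+\sum_{i>j}\frac{x_i}{x_j-x_i}(1-K_{i,j})-(j-1)$. $\alpha$ is generic if it is a formal parameter or a complex number that is neither $0$ nor a negative rational. For generic $\alpha$, the non-symmetric Jack polynomial $E_\eta(x;\alpha)$ is the unique polynomial $x^\eta+\sum_{\nu\prec\eta}c_{\eta,\nu}x^\nu$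 with $\xi_jE_\eta=\bar\eta_jE_\eta$ for all $j$, where $\bar\eta_j=\alpha\eta_j-\#\{i<j:\eta_i\ge\eta_j\}-\#\{i>j:\eta_i>\eta_j\}$; its coefficients are rational in $\alpha$. A superpartition of bi-degree $(n|m)$ is $\Lambda=(\Lambda_1,\dots,\Lambda_m;\Lambda_{m+1},\dots,\Lambda_N)$ of nonnegative integers with $\Lambda_1\ge\dots\ge\Lambda_m$, $\Lambda_{m+1}\ge\dots\ge\Lambda_N$, $\sum\Lambda_i=n$; it is strict if $\Lambda_1>\dots>\Lambda_m$. $\Lambda^\circledast=(\Lambda_1+1,\dots,\Lambda_m+1,\Lambda_{m+1},\dots,\Lambda_N)^+$, $\Lambda^*=(\Lambda_1,\dots,\Lambda_N)^+$. Dominance: $\Lambda>\Omega$ iff $\Lambda^*>\Omega^*$, or $\Lambda^*=\Omega^*$ and $\Lambda^\circledast>\Omega^\circledast$. With $\eta_\Lambda=(\Lambda_m,\dots,\Lambda_1,\Lambda_N,\dots,\Lambda_{m+1})$: $P^{AS}_\Lambda=c\,\mathrm{Asym}_I\mathrm{Sym}_JE_{\eta_\Lambda}$, $P^{AA}_\Lambda=c\,\mathrm{Asym}_I\mathrm{Asym}_JE_{\eta_\Lambda}$, $P^{SA}_\Lambda=c\,\mathrm{Sym}_I\mathrm{Asym}_JE_{\eta_\Lambda}$, $P^{SS}_\Lambda=c\,\mathrm{Sym}_I\mathrm{Sym}_JE_{\eta_\Lambda}$, where the constant $c$ (independent of $\alpha$) makes the coefficient of $x_1^{\Lambda_1}\cdots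 x_N^{\Lambda_N}$ equal to $1$. Index sets: AS: strict; AA: strict with $\Lambda_{m+1}>\dots>\Lambda_N$; SA: $\Lambda_{m+1}>\dots>\Lambda_N$; SS: all. Monomials, with $\lambda=(\Lambda_1,\dots,\Lambda_m)$, $\mu=(\Lambda_{m+1},\dots,\Lambda_N)$: $m^{AS}_\Lambda=a_\lambda(x_1,\dots,x_m)m_\mu(x_{m+1},\dots,x_N)$, $m^{AA}_\Lambda=a_\lambda a_\mu$, $m^{SA}_\Lambda=m_\lambda a_\mu$, $m^{SS}_\Lambda=m_\lambda m_\mu$ (same variable blocks), where $a_\nu(y_1,\dots,y_p)=\sum_{\sigma\in S_p}\mathrm{sgn}(\sigma)y_{\sigma(1)}^{\nu_1}\cdots y_{\sigma(p)}^{\nu_p}$ and $m_\nu(y)$ is the sum of all distinct monomials obtained by permuting the exponents of $y_1^{\nu_1}\cdots y_p^{\nu_p}$. *)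

(* Defs.v *)
From HB Require Import structures.
From mathcomp Require Import all_boot all_order all_algebra all_fingroup.
From mathcomp Require classical_sets.
From mathcomp Require Import reals complex.
From mathcomp Require Import mpoly.

Set Implicit Arguments.
Unset Strict Implicit.
Unset Printing Implicit Defensive.

Import Order.TTheory GRing.Theory Num.Theory.
Local Open Scope ring_scope.

(* The parameter [alpha] lives in the field C(alpha): this is the field of
   rational functions over C when [alpha] is formal, and C itself when [alpha]
   is a complex number. *)
Inductive generic (R : realType) : forall F : fieldType, F -> Prop :=
| generic_formal :
    @generic R {fraction {poly R[i]}} (FracField.tofrac 'X)
| generic_complex (z : R[i]) :
    z != 0 -> (forall q : rat, q < 0 -> z != ratr q) -> @generic R R[i] z.

(* Partitions are nonincreasing sequences of naturals; trailing zeros are kept,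
   so that those attached to a composition in N parts have size N. *)
Section Partitions.

Local Open Scope nat_scope.

Definition decreasing_rearr (s : seq nat) : seq nat := sort geq s.

Definition partial_sums_ge (s t : seq nat) : bool :=
  [forall k : 'I_(maxn (size s) (size t)).+1,
     sumn (take k t) <= sumn (take k s)].

Definition part_ge (lam mu : seq nat) : bool :=
  (sumn lam == sumn mu) && partial_sums_ge lam mu.

Definition part_gt (lam mu : seq nat) : bool := (lam != mu) && part_ge lam mu.

Definition conj_part (lam : seq nat) : seq nat :=
  [seq count (fun r => j < r) lam | j <- iota 0 (head 0 lam)].

(* Rows are numbered from 0, hence the weight [i] where the usual formula has
   [i - 1]. *)
Definition part_b (lam : seq nat) : nat :=
  \sum_(i < size lam) i * nth 0 lam i.

End Partitions.

(* Compositions in N parts are multinomials 'X_{1..N}, so that x^eta is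
   'X_[eta]. *)
Section Compositions.

Variable N : nat.
Implicit Types eta nu : 'X_{1..N}.

Definition comp_part eta : seq nat := decreasing_rearr eta.

Definition comp_gt eta nu : bool :=
  [&& mdeg eta == mdeg nu, eta != nu &
      part_gt (comp_part eta) (comp_part nu)
      || (comp_part eta == comp_part nu) && partial_sums_ge eta nu].

End Compositions.

Section Superpartitions.

Local Open Scope nat_scope.

Variables N m : nat.
Implicit Types (K : {set 'I_N}) (L G : 'X_{1..N}).

(* The variables x_1, ..., x_N are 'X_0, ..., 'X_(N - 1). *)
Definition blockI : {set 'I_N} := [set i : 'I_N | i < m].
Definition blockJ : {set 'I_N} := [set i : 'I_N | m <= i].

Definition weakly_decreasing K L : bool :=
  [forall i in K, forall j in K, (i < j) ==> (L j <= L i)].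

Definition strictly_decreasing K L : bool :=
  [forall i in K, forall j in K, (i < j) ==> (L j < L i)].

Definition superpartition (n : nat) L : bool :=
  [&& weakly_decreasing blockI L, weakly_decreasing blockJ L & mdeg L == n].

Definition sp_star L : seq nat := comp_part L.

Definition sp_circ L : seq nat :=
  decreasing_rearr [seq (if i < m then (L i).+1 else L i) | i : 'I_N <- enum 'I_N].

Definition sp_gt L G : bool :=
  part_gt (sp_star L) (sp_star G)
  || (sp_star L == sp_star G) && part_gt (sp_circ L) (sp_circ G).

Definition eta_of L : 'X_{1..N} :=
  [multinom nth 0 (rev (take m L) ++ rev (drop m L)) i | i < N].

End Superpartitions.

Variant symmetry_type := AS | AA | SA | SS.

Definition index_set (N m : nat) (T : symmetry_type) (L : 'X_{1..N}) : bool :=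
  match T with
  | AS => strictly_decreasing (blockI N m) L
  | AA => strictly_decreasing (blockI N m) L
          && strictly_decreasing (blockJ N m) L
  | SA => strictly_decreasing (blockJ N m) L
  | SS => true
  end.

Section Operators.

Variables (F : fieldType) (N : nat).
Implicit Types (p q f : {mpoly F[N]}) (K : {set 'I_N}) (L : 'X_{1..N}).

(* [msym s f] is f(x_(s 1), ..., x_(s N)). *)
Definition exchange (i j : 'I_N) f : {mpoly F[N]} := msym (tperm i j) f.

(* The quotient p / q when q divides p in the polynomial ring; it is unique
   for q <> 0. *)
Definition exact_quot p q : {mpoly F[N]} :=
  classical_sets.xget 0 (fun r => r * q = p).

Definition divided_difference (i j : 'I_N) f : {mpoly F[N]} :=
  exact_quot (f - exchange i j f) ('X_j - 'X_i).

Lemma divided_differenceP (i j : 'I_N) f :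
  divided_difference i j f * ('X_j - 'X_i) = f - exchange i j f.
Proof.
rewrite /divided_difference /exact_quot.
suff [r Hr] : exists r, r * ('X_j - 'X_i) = f - exchange i j f.
  by case: classical_sets.xgetP => [x _ //|/(_ r)].
pose D g := exists r : {mpoly F[N]}, r * ('X_j - 'X_i) = g - exchange i j g.
have DM g h : D g -> D h -> D (g * h).
  move=> [r Hr] [t Ht]; exists (g * t + r * exchange i j h).
  rewrite mulrDl -mulrA Ht mulrAC Hr /exchange msymM.
  by rewrite mulrBr mulrBl addrA subrK.
have DC c : D c%:MP by exists 0; rewrite /exchange /msym mmapC subrr mul0r.
have DX k : D 'X_k.
  rewrite /D /exchange msymX.
  have -> : 'X_[[multinom U_(k)%MM (((tperm i j)^-1)%g i0) | i0 < N]]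
            = 'X_(tperm i j k) :> {mpoly F[N]}.
    congr ('X_[_]); apply/mnmP => l; rewrite mnmE !mnm1E tpermV.
    by rewrite -(inj_eq (@perm_inj _ (tperm i j))) tpermK.
  case: tpermP => [->|->|_ _].
  - by exists (-1); rewrite mulN1r opprB.
  - by exists 1; rewrite mul1r.
  - by exists 0; rewrite mul0r subrr.
elim/mpolyind: f => [|c mm p _ _ [r Hr]]; first by rewrite -mpolyC0; exact: DC.
have [t Ht] : D (c *: 'X_[mm]).
  rewrite -mul_mpolyC mpolyXE_id; apply: (DM) => //.
  elim/big_ind: _ => [||k _]; [exact: (DC 1) | exact: DM |].
  elim: (mm k) => [|e IH]; first exact: (DC 1).
  by rewrite exprS; apply: (DM).
exists (t + r); rewrite mulrDl Ht Hr /exchange msymD.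
by rewrite opprD addrACA.
Qed.

Definition Asym K f : {mpoly F[N]} :=
  \sum_(s : 'S_N | perm_on K s) (-1) ^+ s *: msym s f.

Definition Sym K f : {mpoly F[N]} := \sum_(s : 'S_N | perm_on K s) msym s f.

(* a_lam in the variables of the block K, where lam is the restriction of L to
   K; the permutations of the block are those of S_K. *)
Definition alt_monomial K L : {mpoly F[N]} :=
  \sum_(s : 'S_N | perm_on K s) (-1) ^+ s *: \prod_(i in K) 'X_(s i) ^+ L i.

(* m_lam in the variables of the block K, where lam is the restriction of L to
   K; [undup] removes the repeated monomials. *)
Definition sym_monomial K L : {mpoly F[N]} :=
  \sum_(nu <- undup
     [seq [multinom (if i \in K then L ((s : 'S_N) i) else 0%N) | i < N]
     | s <- enum (perm_on K)]) 'X_[nu].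

Definition prescribed_monomial (m : nat) (T : symmetry_type) L :
    {mpoly F[N]} :=
  let I := blockI N m in let J := blockJ N m in
  match T with
  | AS => alt_monomial I L * sym_monomial J L
  | AA => alt_monomial I L * alt_monomial J L
  | SA => sym_monomial I L * alt_monomial J L
  | SS => sym_monomial I L * sym_monomial J L
  end.

Definition prescribed_symmetrization (m : nat) (T : symmetry_type) f :
    {mpoly F[N]} :=
  let I := blockI N m in let J := blockJ N m in
  match T with
  | AS => Asym I (Sym J f)
  | AA => Asym I (Asym J f)
  | SA => Sym I (Asym J f)
  | SS => Sym I (Sym J f)
  end.

Variable alpha : F.

(* Indices start at 0, hence the last term is [j] instead of [j - 1]. *)
Definition cherednik (j : 'I_N) f : {mpoly F[N]} :=
  alpha *: ('X_j * f^`M(j))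
  + \sum_(i < N | (i < j)%N) 'X_j * divided_difference i j f
  + \sum_(i < N | (j < i)%N) 'X_i * divided_difference i j f
  - (j : nat)%:R *: f.

Definition ham_H f : {mpoly F[N]} := \sum_(i < N) cherednik i (cherednik i f).

Definition ham_I (m : nat) f : {mpoly F[N]} :=
  \sum_(i < N | (i < m)%N) cherednik i f.

Definition eta_bar (eta : 'X_{1..N}) (j : 'I_N) : F :=
  alpha * (eta j)%:R
  - #|[set i : 'I_N | (i < j)%N && (eta j <= eta i)%N]|%:R
  - #|[set i : 'I_N | (j < i)%N && (eta j < eta i)%N]|%:R.

(* The finite type 'X_{1..N < d.+1} contains all compositions of degree d. *)
Definition is_nsJack (eta : 'X_{1..N}) (E : {mpoly F[N]}) : Prop :=
  (exists c : 'X_{1..N} -> F,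
     E = 'X_[eta] + \sum_(nu : 'X_{1..N < (mdeg eta).+1} | comp_gt eta nu)
                       c nu *: 'X_[nu])
  /\ (forall j : 'I_N, cherednik j E = eta_bar eta j *: E).

Definition nsJack (eta : 'X_{1..N}) : {mpoly F[N]} :=
  classical_sets.xget 0 (is_nsJack eta).

Definition Jack_prescribed (m : nat) (T : symmetry_type) L : {mpoly F[N]} :=
  let f := prescribed_symmetrization m T (nsJack (eta_of m L)) in
  (f@_L)^-1 *: f.

Definition part_eps (lam : seq nat) : F :=
  alpha * (part_b (conj_part lam))%:R - (part_b lam)%:R.

Definition eigen_d L : F :=
  2%:R * alpha * part_eps (sp_star L) + alpha ^+ 2 * (sumn (sp_star L))%:R
  + (N * (N - 1) * (2 * N - 1))%:R / 6%:R.

(* The cell in row [i] and column [j], both numbered from 0, has content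
   alpha j - i. *)
Definition eigen_e (m : nat) L : F :=
  \sum_(i < N) \sum_(nth 0%N (sp_star L) i <= j < nth 0%N (sp_circ m L) i)
    (alpha * j%:R - i%:R).

Definition propB1 (m n : nat) (T : symmetry_type) L (P : {mpoly F[N]}) : Prop :=
  exists c : 'X_{1..N} -> F,
    P = prescribed_monomial m T L
        + \sum_(G : 'X_{1..N < n.+1}
                 | [&& superpartition m n G, index_set m T G & sp_gt m L G])
             c G *: prescribed_monomial m T G.

Definition propB2 (m : nat) (P : {mpoly F[N]}) : Prop :=
  exists d e : F, ham_H P = d *: P /\ ham_I m P = e *: P.

End Operators.

(* Main.v *)
(** Every nonzero joint eigenvector of the Cherednik operators with eigenvalues
    [eta_bar eta] is supported below [eta] in the Bruhat-type order [bruhat_le],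
    because the operators are triangular for it and [eta_bar] determines [eta].
    Such eigenvectors are built by the Knop-Sahi recursion: adjacent exchanges
    intertwine the operators up to a constant, and [raise] (multiplication by x_N
    after a cyclic shift) intertwines them up to [alpha].  Commutativity of the
    operators is never used.

    The operator H commutes with all permutations and I with those preserving the
    two blocks, so the symmetrization of [E_eta] is an eigenvector.  Since
    [eta_Lambda] is the Bruhat minimum of its orbit, the coefficient of x^Lambda is,
    up to sign, a positive integer, and every other superpartition in the
    support is smaller than Lambda.

    Uniqueness: at a Bruhat-maximal monomial x^nu of a joint eigenvector of H and I
    the eigenvalues are [d_nu] and [e_nu].  Both are expressed through the content
    sums alpha sum_i C(s_i, 2) - sum_i (i - 1) s_i of the partitions s = nu^* and
    nu^circledast, and these are strictly monotone for dominance, in the sense that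
    a difference is alpha a + b with a, b natural numbers, not both zero. *)

Require Import Defs.
From mathcomp Require Import all_boot all_order all_algebra all_fingroup.
From mathcomp Require Import zify ring.
From mathcomp Require boolp.
From mathcomp Require Import reals complex.
From mathcomp Require Import mpoly.

Set Implicit Arguments.
Unset Strict Implicit.
Unset Printing Implicit Defensive.

Import GRing.Theory.
Local Open Scope ring_scope.

(** * Dominance through excess functions *)

Section Excess.

Local Open Scope nat_scope.

Implicit Types s t : seq nat.

(** Dominance is defined through sorted partial sums, which are awkward for the two comparisons
    needed throughout: between unsorted compositions, and after adding one to the parts of the first
    block. The number of diagram cells beyond column [x], obtained here by truncated subtraction,
    describes dominance dually and ignores the order of the parts. Adding one to some parts raises
    it by the number of those parts that are at least [x]. Both levels of the superpartition order,
    and the Bruhat order above them, thus become pointwise inequalities between counting functions.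

    A second obstacle is that [nsJack] is a mere choice among the solutions triangular for
    [comp_gt], an order too weak to control the support after symmetrization. The sharper support is
    recovered from the eigenvalue equations, so it holds for whichever solution is chosen. *)

Definition excess s x : nat := \sum_(y <- s) (y - x).

Lemma excess_cons y s x : excess (y :: s) x = (y - x) + excess s x.
Proof. by rewrite /excess big_cons. Qed.

Lemma excess0 s : excess s 0 = sumn s.
Proof. by rewrite /excess sumnE; apply: eq_bigr => y _; rewrite subn0. Qed.

Lemma perm_excess s t : perm_eq s t -> excess s =1 excess t.
Proof. by move=> st x; apply: perm_big. Qed.

Lemma excess_eq0 s x : all (geq x) s -> excess s x = 0.
Proof.
elim: s => [|y s IH] /=; first by rewrite /excess big_nil.
by rewrite excess_cons => /andP[yx /IH ->]; lia.
Qed.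

Lemma geq_trans : transitive geq.
Proof. by move=> a b c /= ba cb; apply: leq_trans cb ba. Qed.

Lemma sorted_geq_cons y s : sorted geq (y :: s) -> all (geq y) s /\ sorted geq s.
Proof.
by move=> /= ys; split; [exact: order_path_min geq_trans ys | exact: path_sorted ys].
Qed.

Lemma sumn_take_le s k x : sumn (take k s) <= k * x + excess s x.
Proof.
elim: s k => [|y s IH] [|k] //=; rewrite excess_cons.
by have := IH k; rewrite mulSn; lia.
Qed.

Lemma sumn_take_nth s k : sorted geq s ->
  sumn (take k s) = k * nth 0 s k + excess s (nth 0 s k).
Proof.
elim: s k => [|y s IH] k; first by rewrite nth_nil muln0 /excess big_nil.
move=> /sorted_geq_cons[ys ss]; case: k => [|k] /=.
  by rewrite excess_eq0 //= leqnn.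
rewrite excess_cons IH // mulSn; suff: nth 0 s k <= y by lia.
case: (ltnP k (size s)) => ks; last by rewrite nth_default.
exact: (allP ys _ (mem_nth 0 ks)).
Qed.

Lemma excess_count s x : sorted geq s ->
  excess s x + count (ltn x) s * x = sumn (take (count (ltn x) s) s).
Proof.
elim: s => [|y s IH]; first by rewrite /excess big_nil.
move=> /sorted_geq_cons[ys ss] /=; rewrite excess_cons.
case: (ltnP x y) => xy /=; first by rewrite -IH // mulSn; lia.
have xs : all (geq x) s.
  by apply/allP => z /(allP ys) /= zy; apply: leq_trans zy xy.
have -> : count (ltn x) s = 0.
  by apply/eqP; rewrite -leqn0 leqNgt -has_count -all_predC;
     apply/allP => z /(allP xs) /=; rewrite -leqNgt.
by rewrite excess_eq0 //=; lia.
Qed.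

(** Legendre-type duality. For sorted [s], the partial sum at [k] is the minimum over [x] of
    [k * x + excess s x], attained at the part of index [k]; conversely [excess s x] is the maximum
    over [k] of the partial sum minus [k * x], attained when [k] is the number of parts exceeding
    [x]. *)
Lemma part_geP s t : sorted geq s -> sorted geq t ->
  part_ge s t <->
  sumn s = sumn t /\ forall x, excess t x <= excess s x.
Proof.
move=> ss st; split.
  move=> /andP[/eqP sst /forallP H]; split=> // x.
  have hk : count (ltn x) t < (maxn (size s) (size t)).+1.
    by rewrite ltnS leq_max count_size orbT.
  have := H (Ordinal hk); rewrite /= -excess_count //.
  by have := sumn_take_le s (count (ltn x) t) x; lia.
move=> [sst H]; apply/andP; split; first exact/eqP.
apply/forallP => k; rewrite (sumn_take_nth k ss).
by have := H (nth 0 s k); have := sumn_take_le t k (nth 0 s k); lia.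
Qed.

Lemma sumn_take_inj s t : size s = size t ->
  (forall k, sumn (take k s) = sumn (take k t)) -> s = t.
Proof.
elim: s t => [|x s IH] [|y t] //= [sz] H.
have xy : x = y by have := H 1; rewrite /= !take0 /=; lia.
by rewrite xy (IH t) // => k; have := H k.+1; rewrite /= xy; lia.
Qed.

Lemma sorted_excess_inj s t : sorted geq s -> sorted geq t -> size s = size t ->
  excess s =1 excess t -> s = t.
Proof.
move=> ss st sz H; apply: sumn_take_inj => // k; apply/eqP; rewrite eqn_leq.
rewrite {2}(sumn_take_nth k ss) {1}(sumn_take_nth k st) -{1}H {1}H.
by rewrite -{1}H !sumn_take_le H sumn_take_le.
Qed.

Lemma geq_total : total geq.
Proof. by move=> x y; apply: leq_total. Qed.

Lemma sorted_rearr s : sorted geq (decreasing_rearr s).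
Proof. exact: sort_sorted geq_total s. Qed.

Lemma perm_rearr s : perm_eq (decreasing_rearr s) s.
Proof. by rewrite perm_sort. Qed.

Lemma excess_rearr s : excess (decreasing_rearr s) =1 excess s.
Proof. exact: perm_excess (perm_rearr s). Qed.

Lemma size_rearr s : size (decreasing_rearr s) = size s.
Proof. exact: size_sort. Qed.

Lemma sumn_rearr s : sumn (decreasing_rearr s) = sumn s.
Proof. by rewrite -!excess0 excess_rearr. Qed.

Lemma rearr_geP s t :
  part_ge (decreasing_rearr s) (decreasing_rearr t) <->
  sumn s = sumn t /\ forall x, excess t x <= excess s x.
Proof.
rewrite part_geP ?sorted_rearr // !sumn_rearr; split=> -[-> H]; split=> // x;
  by have := H x; rewrite !excess_rearr.
Qed.

Lemma rearr_eqP s t : size s = size t ->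
  decreasing_rearr s = decreasing_rearr t <-> excess s =1 excess t.
Proof.
move=> sz; split=> [H x|H]; first by rewrite -excess_rearr H excess_rearr.
apply: sorted_excess_inj; rewrite ?sorted_rearr ?size_rearr // => x.
by rewrite !excess_rearr.
Qed.

Lemma part_b_cons x s : part_b (x :: s) = sumn s + part_b s.
Proof.
rewrite /part_b big_ord_recl mul0n add0n sumnE (big_nth 0) big_mkord.
by rewrite -big_split; apply: eq_bigr => i _ /=; rewrite /bump leq0n mulnDl mul1n.
Qed.

(** The part of index [i] occurs in [size s - i] of the nonempty prefixes, and [part_b] counts it
    [i] more times. *)
Lemma sum_takes_part_b s :
  (\sum_(k < size s) sumn (take k.+1 s)) + part_b s = size s * sumn s.
Proof.
elim: s => [|x s IH]; first by rewrite /part_b !big_ord0.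
rewrite part_b_cons /= big_split /= sum_nat_const card_ord.
rewrite big_ord_recl take0 /=; under eq_bigr do rewrite /bump leq0n add1n.
set S := (\sum_(i < _) _) in IH *; move: IH.
by rewrite mulnDr (mulSn _ (sumn s)) => <-; lia.
Qed.


Lemma sum_subn_bin2 y M : y <= M -> \sum_(k < M) (y - k.+1) = 'C(y, 2).
Proof.
elim: M y => [|M IH] [|y] yM //; first by rewrite big_ord0.
  by rewrite big1.
rewrite big_ord_recl subSS subn0 binS bin1 addnC; congr (_ + _).
by rewrite -IH //; apply: eq_bigr => i _; rewrite subSS.
Qed.

Lemma sum_excess_bin2 s M : all (geq M) s ->
  \sum_(k < M) excess s k.+1 = \sum_(y <- s) 'C(y, 2).
Proof.
move=> sM; rewrite exchange_big /= !big_seq; apply: eq_bigr => y ys.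
by rewrite sum_subn_bin2 //; exact: (allP sM).
Qed.

(** The sum of binomials is the sum of the excesses over all positive thresholds, and dominance
    compares these one by one. A weak inequality is enough: strictness comes from [part_b]. *)
Lemma part_gt_bin2 s t : sorted geq s -> sorted geq t -> part_gt s t ->
  \sum_(y <- t) 'C(y, 2) <= \sum_(y <- s) 'C(y, 2).
Proof.
move=> ss st /andP[_ /part_geP[] // _ H].
(* Any common bound for the parts will do, so that both sums run over the same thresholds. *)
pose M := sumn s + sumn t.
have sM r : r \in [:: s; t] -> all (geq M) r.
  move=> rst; apply/allP => y yr /=.
  have: y <= sumn r by rewrite sumnE (big_rem y) //= leq_addr.
  by move: rst; rewrite !inE => /orP[] /eqP->; rewrite /M; lia.
rewrite -!(sum_excess_bin2 (sM _ _)) ?inE ?eqxx ?orbT //.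
by apply: leq_sum => k _.
Qed.

(** [part_b] is complementary to the sum of the partial sums. If it did not increase strictly, all
    the inequalities between partial sums would be equalities, and the two partitions would
    coincide. *)
Lemma part_gt_part_b s t : size s = size t -> part_gt s t -> part_b s < part_b t.
Proof.
move=> sz /andP[nst /andP[/eqP sum_st /forallP H]].
have Hk k : sumn (take k t) <= sumn (take k s).
  case: (ltnP k (maxn (size s) (size t)).+1) => hk; first exact: (H (Ordinal hk)).
  by rewrite !take_oversize ?sum_st //; move: hk; rewrite -sz maxnn; lia.
have := sum_takes_part_b s; have := sum_takes_part_b t; rewrite sum_st sz => <- E.
rewrite ltnNge; apply/negP => bts; case/negP: nst; apply/eqP.
have Hle : \sum_(k < size t) sumn (take k.+1 s) <= \sum_(k < size t) sumn (take k.+1 t).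
  by lia.
have Heq : forall k : 'I_(size t), sumn (take k.+1 t) = sumn (take k.+1 s).
  have [_] := @leqif_sum _ xpredT (fun k : 'I_(size t) =>
    sumn (take k.+1 t) == sumn (take k.+1 s)) (fun k => sumn (take k.+1 t))
    (fun k => sumn (take k.+1 s)) (fun k _ => leqif_eq (Hk k.+1)).
  rewrite eqn_leq Hle leq_sum /= => [/esym /forallP E' k|k _]; last exact: Hk.
  exact/eqP/E'.
apply: sumn_take_inj => // -[|k]; first by rewrite !take0.
case: (ltnP k (size t)) => kt; first by rewrite -(Heq (Ordinal kt)).
by rewrite !take_oversize ?sum_st //; lia.
Qed.

Lemma part_b_conj s : sorted geq s ->
  part_b (conj_part s) = \sum_(y <- s) 'C(y, 2).
Proof.
move=> ss; rewrite /part_b size_map size_iota.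
transitivity (\sum_(i < head 0 s) \sum_(y <- s) i * (i < y)).
  apply: eq_bigr => i _; rewrite (nth_map 0) ?size_iota // nth_iota // add0n.
  by rewrite -big_distrr /= -sum1_count big_mkcond.
rewrite exchange_big /= !big_seq; apply: eq_bigr => y ys.
have yh : y <= head 0 s.
  case: s ss ys => //= x s /(order_path_min geq_trans) /allP xs.
  by rewrite inE => /orP[/eqP->|/xs].
rewrite -bin2_sum big_mkord (big_ord_widen _ (fun i => i) yh) [RHS]big_mkcond /=.
by apply: eq_bigr => i _; case: ltnP; rewrite ?muln1 ?muln0.
Qed.

End Excess.

(** * Orders on compositions *)

Section Orders.

Local Open Scope nat_scope.

Variable N : nat.
Implicit Types (eta nu kap : 'X_{1..N}) (v : 'I_N -> nat).

Lemma mnm_seqE eta : eta = [seq eta i | i <- enum 'I_N] :> seq nat.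
Proof. by rewrite -[LHS]map_tnth_enum. Qed.

Lemma size_mnm eta : size eta = N.
Proof. exact: size_tuple. Qed.

Lemma excess_map v x : excess [seq v i | i <- enum 'I_N] x = \sum_(i < N) (v i - x).
Proof. by rewrite /excess big_map big_enum. Qed.

Lemma excess_mnm eta x : excess eta x = \sum_(i < N) (eta i - x).
Proof. by rewrite {1}mnm_seqE excess_map. Qed.

Lemma sumn_mnm eta : sumn eta = mdeg eta.
Proof. by rewrite sumnE. Qed.

Definition headcount k eta x : nat := \sum_(i < N | i < k) (x <= eta i).

Lemma headcountS (i : 'I_N) eta x :
  headcount i.+1 eta x = (x <= eta i) + headcount i eta x.
Proof.
rewrite /headcount (bigD1 i) ?leqnn //=; congr (_ + _); apply: eq_bigl => j.
by rewrite ltnS ltn_neqAle andbC.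
Qed.

(* The tableau criterion for the Bruhat order on the rearrangements of a
   composition.  It is strictly finer than comparing partial sums, and unlike the
   latter it controls Lambda^circledast: for N = 6 and m = 3 the partial sums of
   (2,3,7,1,4,5) dominate those of (1,4,5,2,3,7), but the associated
   superpartitions are incomparable. *)
Definition bruhat_le nu eta : Prop :=
  [/\ mdeg nu = mdeg eta, forall x, excess nu x <= excess eta x
    & excess nu =1 excess eta -> forall k x, headcount k nu x <= headcount k eta x].

(** Of the counts in [bruhat_le] only the one at the block boundary is kept. This is the dominance
    order of superpartitions, extended to a preorder on all compositions that ignores the order
    inside the blocks. *)
Definition super_le m nu eta : Prop :=
  [/\ mdeg nu = mdeg eta, forall x, excess nu x <= excess eta x
    & excess nu =1 excess eta -> forall x, headcount m nu x <= headcount m eta x].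

Lemma bruhat_refl eta : bruhat_le eta eta.
Proof. by split. Qed.

Lemma bruhat_trans kap nu eta : bruhat_le nu kap -> bruhat_le kap eta -> bruhat_le nu eta.
Proof.
move=> [d1 e1 h1] [d2 e2 h2]; split; first by rewrite d1.
  by move=> x; apply: leq_trans (e1 x) (e2 x).
move=> E k x.
have E1 : excess nu =1 excess kap.
  by move=> y; apply/eqP; rewrite eqn_leq e1 E e2.
apply: leq_trans (h1 E1 k x) _; apply: h2 => y.
by rewrite -E1 E.
Qed.

Lemma bruhat_anti nu eta : bruhat_le nu eta -> bruhat_le eta nu -> nu = eta.
Proof.
move=> [d1 e1 h1] [d2 e2 h2].
have E : excess nu =1 excess eta by move=> y; apply/eqP; rewrite eqn_leq e1 e2.
have H k x : headcount k nu x = headcount k eta x.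
  by apply/eqP; rewrite eqn_leq h1 // h2 // => y; rewrite E.
apply/mnmP => i.
have Hi x : (x <= nu i) = (x <= eta i).
  by have := H i.+1 x; rewrite !headcountS H => /addIn; do 2 case: (_ <= _).
by apply/eqP; rewrite eqn_leq -Hi leqnn Hi leqnn.
Qed.

Lemma bruhat_super m nu eta : bruhat_le nu eta -> super_le m nu eta.
Proof. by case=> d e h; split=> // E x; apply: h. Qed.

(** Adding one to a part [y] increases the truncated difference [y - x] exactly when [x <= y]. *)
Lemma excess_circ m eta x :
  excess [seq (if i < m then (eta i).+1 else eta i) | i : 'I_N <- enum 'I_N] x =
  excess eta x + headcount m eta x.
Proof.
rewrite excess_map excess_mnm /headcount [X in _ + X]big_mkcond -big_split /=.
by apply: eq_bigr => i _; case: (i < m); lia.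
Qed.

Lemma headcount0 m eta : headcount m eta 0 = \sum_(i < N | i < m) 1.
Proof. by []. Qed.

Lemma sp_star_eqP eta nu : sp_star eta = sp_star nu <-> excess eta =1 excess nu.
Proof. by apply: rearr_eqP; rewrite !size_mnm. Qed.

Lemma sp_circ_eqP m eta nu : excess eta =1 excess nu ->
  sp_circ m eta = sp_circ m nu <-> headcount m eta =1 headcount m nu.
Proof.
move=> E; rewrite rearr_eqP ?size_map //.
split=> H x; have := H x; rewrite !excess_circ E; first by move/addnI.
by move->.
Qed.

Lemma sp_star_gtP eta nu : part_gt (sp_star eta) (sp_star nu) <->
  [/\ mdeg nu = mdeg eta, forall x, excess nu x <= excess eta x
    & ~ excess nu =1 excess eta].
Proof.
split.
  move=> /andP[/eqP ne /rearr_geP[]]; rewrite !sumn_mnm => d e; split=> // E.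
  by apply/ne/sp_star_eqP => x; rewrite E.
move=> [d e ne]; apply/andP; split; last by apply/rearr_geP; rewrite !sumn_mnm.
by apply/eqP => /sp_star_eqP E; apply: ne => x; rewrite E.
Qed.

Lemma sp_circ_gtP m eta nu : excess eta =1 excess nu ->
  part_gt (sp_circ m eta) (sp_circ m nu) <->
  (forall x, headcount m nu x <= headcount m eta x)
  /\ ~ headcount m nu =1 headcount m eta.
Proof.
move=> E; split.
  move=> /andP[/eqP ne /rearr_geP[d e]]; split=> [x|H].
    by have := e x; rewrite !excess_circ E leq_add2l.
  by apply/ne/sp_circ_eqP => // x; rewrite H.
move=> [d ne]; apply/andP; split.
  by apply/eqP => /sp_circ_eqP H; apply: ne => x; rewrite H.
apply/rearr_geP; split=> [|x]; last by rewrite !excess_circ E leq_add2l.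
by rewrite -!excess0 !excess_circ E !headcount0.
Qed.

Lemma sp_gtP m eta nu : sp_gt m eta nu <-> super_le m nu eta /\ ~ super_le m eta nu.
Proof.
split.
  case/orP => [/sp_star_gtP[d e ne]|/andP[/eqP/sp_star_eqP E]].
    split; first by split.
    by case=> _ e' _; apply: ne => x; apply/eqP; rewrite eqn_leq e e'.
  move/(sp_circ_gtP _ E) => [h ne].
  split; first by split=> // [|x]; rewrite -?sumn_mnm -?excess0 E.
  by case=> _ _ /(_ E) h'; apply: ne => x; apply/eqP; rewrite eqn_leq h h'.
move=> [[d e h] ng]; apply/orP.
case: (eqVneq (sp_star eta) (sp_star nu)) => [/sp_star_eqP E|/eqP ne]; last first.
  left; apply/sp_star_gtP; split=> // E; apply/ne/sp_star_eqP => x; by rewrite E.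
right; apply/(sp_circ_gtP _ E); split=> [|H]; first by apply: h => x; rewrite E.
by apply: ng; split=> // [x|_ x]; rewrite ?E ?H.
Qed.

Lemma sumn_take_mnm eta k : k <= N -> sumn (take k eta) = \sum_(i < N | i < k) eta i.
Proof.
move=> kN; rewrite (big_ord_narrow kN) sumnE (big_nth 0) big_mkord.
rewrite size_takel ?size_mnm //; apply: eq_bigr => i _.
by rewrite nth_take // (mnm_nth 0).
Qed.

(** Layer-cake summation: it recovers partial sums from head counts, which is how the Bruhat order
    implies the order used to define the non-symmetric Jack polynomials. *)
Lemma sum_headcount k eta M : (forall i, eta i <= M) ->
  \sum_(x < M) headcount k eta x.+1 = \sum_(i < N | i < k) eta i.
Proof.
move=> etaM; rewrite exchange_big /=; apply: eq_bigr => i _.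
rewrite -[RHS]muln1 -[in RHS](card_ord (eta i)) -sum_nat_const.
rewrite (big_ord_widen _ (fun=> 1) (etaM i)) [RHS]big_mkcond /=.
by apply: eq_bigr => j _; case: ltnP.
Qed.

Lemma mnm_le_mdeg eta i : eta i <= mdeg eta.
Proof. by rewrite mdegE (bigD1 i) //= leq_addr. Qed.

Lemma bruhat_comp_gt nu eta : bruhat_le nu eta -> nu != eta -> comp_gt eta nu.
Proof.
move=> [d e h] ne; rewrite /comp_gt d eqxx eq_sym ne /=; apply/orP.
case: (eqVneq (comp_part eta) (comp_part nu)) => [/sp_star_eqP E|/eqP ne']; last first.
  left; apply/sp_star_gtP; split=> // E; apply: ne'; apply/sp_star_eqP => x.
  by rewrite E.
right; apply/forallP => -[k kN] /=; rewrite ltnS !size_mnm maxnn in kN.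
rewrite !sumn_take_mnm //.
rewrite -(@sum_headcount k nu (mdeg eta)); last by move=> i; rewrite -d mnm_le_mdeg.
rewrite -(@sum_headcount k eta (mdeg eta)); last exact: mnm_le_mdeg.
by apply: leq_sum => x _; apply: h => y; rewrite E.
Qed.

Lemma big_pair_split (R : Type) (idx : R) (op : Monoid.com_law idx) (p q : 'I_N)
    (F : 'I_N -> R) : p != q ->
  \big[op/idx]_(i < N) F i =
  op (F p) (op (F q) (\big[op/idx]_(i < N | (i != p) && (i != q)) F i)).
Proof.
move=> pq; rewrite (bigD1 p) //=; congr (op _ _).
by rewrite (bigD1 q) //= eq_sym.
Qed.

Lemma bruhat_pair (p q : 'I_N) nu eta : p < q ->
  nu p + nu q = eta p + eta q ->
  (forall i, i != p -> i != q -> nu i = eta i) ->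
  (minn (eta p) (eta q) < nu p < maxn (eta p) (eta q)) \/
  (nu p = eta q /\ eta q <= eta p) ->
  bruhat_le nu eta.
Proof.
move=> pq sum_pq others range.
have npq : p != q by rewrite neq_ltn pq.
have rest (G : nat -> 'I_N -> nat) :
    \sum_(i < N | (i != p) && (i != q)) G (nu i) i =
    \sum_(i < N | (i != p) && (i != q)) G (eta i) i.
  by apply: eq_bigr => i /andP[ip iq]; rewrite others.
have exc x : excess nu x <= excess eta x.
  rewrite !excess_mnm !(big_pair_split _ _ npq) /= (rest (fun y _ => y - x)).
  by rewrite !addnA leq_add2r; case: range => H; lia.
split=> //.
  by rewrite !mdegE !(big_pair_split _ _ npq) /= (rest (fun y _ => y)) !addnA sum_pq.
move=> E k x; case: range => [range|[nup le]].
  (* At this threshold the new pair has no excess while the old pair has some, so the condition on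
     head counts is vacuous. *)
  have := E (maxn (nu p) (nu q)); rewrite !excess_mnm !(big_pair_split _ _ npq) /=.
  by rewrite (rest (fun y _ => y - _)) !addnA => /addIn; lia.
have nuq : nu q = eta p by lia.
rewrite /headcount !(big_mkcond (fun i : 'I_N => i < k)) !(big_pair_split _ _ npq) /=.
rewrite (rest (fun y i => if i < k then (x <= y) : nat else 0)) nup nuq !addnA.
rewrite leq_add2r; case: (ltnP p k) => pk; case: (ltnP q k) => qk //; lia.
Qed.

End Orders.

(** * Ranks and the spectrum *)

Section Ranks.

Local Open Scope nat_scope.

Variable N : nat.
Implicit Types (eta nu : 'X_{1..N}) (i j : 'I_N) (v : 'I_N -> nat).

(** The order of positions in a stable decreasing sort: ties are broken from left to right. *)
Definition before eta i j : bool :=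
  ((i < j) && (eta j <= eta i)) || ((j < i) && (eta j < eta i)).

Lemma before_irr eta i : before eta i i = false.
Proof. by rewrite /before ltnn. Qed.

Lemma before_trans eta j i k : before eta i j -> before eta j k -> before eta i k.
Proof.
case: (eqVneq i k) => [->|ik]; first by rewrite /before; lia.
by have : (i : nat) != k by []; rewrite /before; lia.
Qed.

Lemma before_total eta i j : i != j -> before eta i j || before eta j i.
Proof.
by move=> ij; have : (i : nat) != j by []; rewrite /before; lia.
Qed.

Lemma rank_subproof eta j : #|[set i | before eta i j]| < N.
Proof.
rewrite -[X in _ < X]card_ord -cardsT; apply: proper_card; rewrite properT.
by apply/eqP => /setP/(_ j); rewrite !inE before_irr.
Qed.

(* The row of the decreasing rearrangement of [eta] that receives the j-th part,
   so that [eta_bar eta j] is [alpha * eta j - rank eta j]. *)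
Definition rank eta j : 'I_N := Ordinal (rank_subproof eta j).

Lemma rank_lt eta i j : before eta i j -> rank eta i < rank eta j.
Proof.
move=> ij; apply: proper_card; apply/properP; split.
  by apply/subsetP => k; rewrite !inE => /before_trans; apply.
by exists i; rewrite inE ?before_irr.
Qed.

Lemma rank_inj eta : injective (rank eta).
Proof.
move=> i j E; apply/eqP; apply/negPn/negP => /(before_total eta).
by case/orP => /rank_lt; rewrite E ltnn.
Qed.

Lemma rank_before eta i j : (rank eta i < rank eta j) = before eta i j.
Proof.
apply/idP/idP => [|/rank_lt //]; case: (eqVneq i j) => [->|]; first by rewrite ltnn.
by move/(before_total eta)/orP => [//|/rank_lt]; lia.
Qed.

Lemma nth_map_enum v i : nth 0 [seq v k | k <- enum 'I_N] i = v i.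
Proof. by rewrite (nth_map i) ?size_enum_ord // nth_ord_enum. Qed.

Lemma nth_rearr_rank eta v j : (forall i k, before eta i k -> v k <= v i) ->
  nth 0 (decreasing_rearr [seq v i | i <- enum 'I_N]) (rank eta j) = v j.
Proof.
move=> v_anti; pose w := perm (@rank_inj eta).
suff -> : decreasing_rearr [seq v i | i <- enum 'I_N] =
          [seq v ((w^-1)%g i) | i <- enum 'I_N].
  by rewrite nth_map_enum -[rank eta j](permE (@rank_inj eta)) permK.
apply: sorted_excess_inj; rewrite ?sorted_rearr ?size_rearr ?size_map //; last first.
  move=> x; rewrite excess_rearr !excess_map.
  by rewrite (reindex_inj (h := (w^-1)%g)) //; exact: perm_inj.
apply/(sortedP 0) => k; rewrite size_map size_enum_ord => kN.
pose k0 := Ordinal (ltnW kN); pose k1 := Ordinal kN.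
rewrite -[k.+1]/(val k1) -[k]/(val k0) !nth_map_enum /=; apply: v_anti.
rewrite -rank_before.
by rewrite -!(permE (@rank_inj eta)) !permKV /=.
Qed.

Lemma nth_sp_star eta j : nth 0 (sp_star eta) (rank eta j) = eta j.
Proof.
by rewrite /sp_star /comp_part mnm_seqE nth_rearr_rank // /before => i k; lia.
Qed.

(** The ranks of [eta] still sort the parts after one is added in the first block: ties already
    favour the smaller positions, and a strict inequality absorbs the added one. *)
Lemma nth_sp_circ m eta j :
  nth 0 (sp_circ m eta) (rank eta j) = if j < m then (eta j).+1 else eta j.
Proof.
rewrite /sp_circ nth_rearr_rank // /before => i k.
by case: (ltnP i m); case: (ltnP k m); lia.
Qed.

Lemma size_sp_star eta : size (sp_star eta) = N.
Proof. by rewrite size_rearr size_mnm. Qed.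

Lemma size_sp_circ m eta : size (sp_circ m eta) = N.
Proof. by rewrite size_rearr size_map size_enum_ord. Qed.

Lemma part_b_sp_star eta : part_b (sp_star eta) = \sum_j rank eta j * eta j.
Proof.
rewrite /part_b size_sp_star (reindex_inj (@rank_inj eta)) /=.
by apply: eq_bigr => j _; rewrite nth_sp_star.
Qed.

Lemma part_b_sp_circ m eta :
  part_b (sp_circ m eta) =
  part_b (sp_star eta) + \sum_(j < N | j < m) rank eta j.
Proof.
rewrite part_b_sp_star /part_b size_sp_circ (reindex_inj (@rank_inj eta)) /=.
rewrite [X in _ + X]big_mkcond -big_split; apply: eq_bigr => j _ /=.
by rewrite nth_sp_circ; case: ifP => _; rewrite ?mulnS ?addn0 // addnC.
Qed.

Lemma bin2_sp_star eta : \sum_(y <- sp_star eta) 'C(y, 2) = \sum_j 'C(eta j, 2).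
Proof.
by rewrite (perm_big _ (perm_rearr _)) /= mnm_seqE big_map big_enum.
Qed.

Lemma bin2_sp_circ m eta : \sum_(y <- sp_circ m eta) 'C(y, 2) =
  \sum_(y <- sp_star eta) 'C(y, 2) + \sum_(j < N | j < m) eta j.
Proof.
rewrite bin2_sp_star (perm_big _ (perm_rearr _)) /= big_map big_enum /=.
rewrite [X in _ + X]big_mkcond -big_split; apply: eq_bigr => j _ /=.
by case: ifP => _; rewrite ?binS ?bin1 ?addn0.
Qed.

End Ranks.

Lemma sqrn_bin2 n : (n ^ 2 = n + 2 * 'C(n, 2))%N.
Proof. by elim: n => // n IH; rewrite binS bin1; nia. Qed.

(** * Eigenvalues in terms of ranks, and their separation *)

Section Spectrum.

Variables (F : fieldType) (alpha : F) (N : nat).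
Implicit Types (eta nu : 'X_{1..N}).

(** The form in which genericity is used. With [a = 0] it says that the field has characteristic
    zero. *)
Hypothesis alpha_gen :
  forall a b : nat, alpha * a%:R + b%:R = 0 -> a = 0%N /\ b = 0%N.

Lemma natF_eq0 b : b%:R = 0 :> F -> b = 0%N.
Proof. by move=> b0; case: (@alpha_gen 0 b); rewrite // mulr0 add0r. Qed.

Lemma natF_neq0 b : b.+1%:R != 0 :> F.
Proof. by apply/eqP => /natF_eq0. Qed.

Lemma natF_inj : injective (GRing.natmul 1 : nat -> F).
Proof.
move=> a b; wlog ab : a b / (a <= b)%N => [H E|].
  by case/orP: (leq_total a b) => ab; [|symmetry]; apply: H.
move=> E; apply/eqP; rewrite eqn_leq ab /= -subn_eq0; apply/eqP/natF_eq0.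
by rewrite natrB // E subrr.
Qed.

Lemma alpha_neq0 : alpha != 0.
Proof. by apply/eqP => a0; case: (@alpha_gen 1 0); rewrite // a0 mul0r add0r. Qed.

Lemma eta_barE eta j : eta_bar alpha eta j = alpha * (eta j)%:R - (rank eta j : nat)%:R.
Proof.
rewrite /eta_bar -addrA -opprD -natrD; congr (_ - _%:R).
rewrite -cardsUI /= [X in (_ + X)%N]eq_card0 ?addn0; last first.
  by move=> i; rewrite !inE; lia.
by apply: eq_card => i; rewrite !inE.
Qed.

(* [eta_bar eta i - eta_bar eta j] is a nonzero combination of [alpha] and [1]
   with coefficients in nat exactly when [i] comes before [j]. *)
Lemma eta_bar_before eta nu i j : eta_bar alpha eta =1 eta_bar alpha nu ->
  before eta i j -> before nu i j.
Proof.
move=> E bij; case: (eqVneq i j) => [ij|]; first by move: bij; rewrite ij before_irr.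
move/(before_total nu)/orP => [//|bji]; exfalso.
have := rank_lt bij; have := rank_lt bji; set a := rank nu j; set b := rank nu i.
set c := rank eta i; set d := rank eta j => ab cd.
have ej : (eta j <= eta i)%N by move: bij; rewrite /before; lia.
have ni : (nu i <= nu j)%N by move: bji; rewrite /before; lia.
have [] := @alpha_gen ((eta i - eta j) + (nu j - nu i)) ((d - c) + (b - a)).
  have := E i; have := E j; rewrite !eta_barE -/a -/b -/c -/d => Ej Ei.
  rewrite !natrD !natrB ?(ltnW ab) ?(ltnW cd) //.
  have -> : alpha * ((eta i)%:R - (eta j)%:R + ((nu j)%:R - (nu i)%:R)) +
    (d%:R - c%:R + (b%:R - a%:R)) =
    ((alpha * (eta i)%:R - c%:R) - (alpha * (nu i)%:R - b%:R)) -
    ((alpha * (eta j)%:R - d%:R) - (alpha * (nu j)%:R - a%:R)) by ring.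
  by rewrite Ei Ej !subrr.
by lia.
Qed.

(** Equal spectra induce the same [before] relation, hence the same ranks; after cancelling these,
    only [alpha] times the parts remains. *)
Lemma eta_bar_inj eta nu : eta_bar alpha eta =1 eta_bar alpha nu -> eta = nu.
Proof.
move=> E; apply/mnmP => j.
have rank_eq : rank eta j = rank nu j :> nat.
  apply: eq_card => i; rewrite !inE; apply/idP/idP; first exact: eta_bar_before.
  by apply: eta_bar_before => k; rewrite E.
have := E j; rewrite !eta_barE rank_eq => /addIr /(mulfI alpha_neq0).
exact: natF_inj.
Qed.

(** For a partition [s], this is the sum of [alpha * j - i] over its cells, rows [i] and columns [j]
    numbered from 0. *)
Definition content_sum (s : seq nat) : F :=
  alpha * (\sum_(y <- s) 'C(y, 2))%:R - (part_b s)%:R.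

Lemma content_sum_gt s t : sorted geq s -> sorted geq t -> size s = size t ->
  part_gt s t -> content_sum s <> content_sum t.
Proof.
move=> ss st sz st_gt; have c := part_gt_bin2 ss st st_gt.
have b := part_gt_part_b sz st_gt; rewrite /content_sum => E.
set x := (\sum_(y <- s) _)%N in c E; set y := (\sum_(y <- t) _)%N in c E.
have [] := @alpha_gen (x - y) (part_b t - part_b s); last by lia.
rewrite !natrB ?(ltnW b) //.
have -> : alpha * (x%:R - y%:R) + ((part_b t)%:R - (part_b s)%:R) =
  (alpha * x%:R - (part_b s)%:R) - (alpha * y%:R - (part_b t)%:R) by ring.
by rewrite E subrr.
Qed.

Lemma part_eps_content eta : part_eps alpha (sp_star eta) = content_sum (sp_star eta).
Proof. by rewrite /part_eps part_b_conj // sorted_rearr. Qed.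

(** Since the same ranks sort both partitions, the row [rank eta j] of the skew diagram holds a cell
    only if [j] lies in the first block; that cell is in column [eta j], and its content is
    [eta_bar alpha eta j]. *)
Lemma eigen_eE m eta :
  eigen_e alpha m eta = \sum_(j < N | (j < m)%N) eta_bar alpha eta j.
Proof.
rewrite /eigen_e (reindex_inj (@rank_inj _ eta)) [RHS]big_mkcond /=.
apply: eq_bigr => j _; rewrite nth_sp_star nth_sp_circ.
case: ifP => _; last by rewrite big_geq.
by rewrite big_nat1 eta_barE.
Qed.

Lemma eigen_e_content m eta :
  eigen_e alpha m eta = content_sum (sp_circ m eta) - content_sum (sp_star eta).
Proof.
rewrite eigen_eE /content_sum bin2_sp_circ part_b_sp_circ !natrD.
rewrite (eq_bigr _ (fun j _ => eta_barE eta j)).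
rewrite sumrB -mulr_sumr -!natr_sum; ring.
Qed.

Lemma sum_sqr_ord : (6 * \sum_(i < N) i ^ 2 = N * (N - 1) * (2 * N - 1))%N.
Proof.
elim: N => [|n IH]; first by rewrite big_ord0.
rewrite big_ord_recr /= mulnDr IH; case: n {IH} => [|n] //.
have -> : (2 * n.+1 - 1 = 2 * n + 1)%N by lia.
have -> : (2 * n.+2 - 1 = 2 * n + 3)%N by lia.
by rewrite -mulnn !subn1 ![_.+1.-1]/=; lia.
Qed.

(** Expanding the squares, the terms in [alpha ^+ 2] are rewritten by [sqrn_bin2], the cross terms
    give [part_b], and the squared ranks sum to the constant because the ranks permute the numbers
    below [N]. *)
Lemma eigen_dE eta : eigen_d alpha eta = \sum_j eta_bar alpha eta j ^+ 2.
Proof.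
rewrite /eigen_d part_eps_content /content_sum bin2_sp_star part_b_sp_star.
rewrite sumn_rearr sumn_mnm mdegE -sum_sqr_ord natrM [6%:R * _ / _]mulrAC divff ?mul1r; last first.
  exact: natF_neq0.
rewrite (reindex_inj (@rank_inj _ eta) (F := fun i : 'I_N => i ^ 2)%N) !natr_sum /=.
rewrite mulrBr !mulr_sumr -sumrB -!big_split /=; apply: eq_bigr => j _.
rewrite eta_barE; set r := (rank eta j : nat).
have := congr1 (GRing.natmul (1 : F)) (sqrn_bin2 (eta j)).
rewrite -/r [(r * _)%:R]natrM !natrX natrD natrM.
move: 'C(eta j, 2)%:R (eta j)%:R => c e H.
transitivity (alpha ^+ 2 * (e + 2%:R * c) - 2%:R * alpha * (r%:R * e) + r%:R ^+ 2).
  by ring.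
by rewrite -H; ring.
Qed.

End Spectrum.

(** * Block permutations and the extremal elements of their orbits *)

Section SuperpartitionOrder.

Local Open Scope nat_scope.

Variables N m : nat.
Implicit Types (eta nu kap L : 'X_{1..N}) (i j : 'I_N) (s t : 'S_N).

(** The multiset of all parts and that of the first block determine that of the second, so this is
    equality up to permutations inside the blocks. *)
Definition super_equiv nu eta : Prop :=
  excess nu =1 excess eta /\ headcount m nu =1 headcount m eta.

Lemma super_equiv_sym nu eta : super_equiv nu eta -> super_equiv eta nu.
Proof. by case=> e h; split=> x; rewrite (e, h). Qed.

Lemma super_equiv_trans kap nu eta :
  super_equiv nu kap -> super_equiv kap eta -> super_equiv nu eta.
Proof. by case=> e1 h1 [e2 h2]; split=> x; rewrite (e1, h1) (e2, h2). Qed.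

Lemma super_equiv_mdeg nu eta : super_equiv nu eta -> mdeg nu = mdeg eta.
Proof. by case=> e _; rewrite -!sumn_mnm -!excess0 e. Qed.

Lemma super_le_equiv nu eta nu' eta' : super_equiv nu nu' -> super_equiv eta eta' ->
  super_le m nu eta -> super_le m nu' eta'.
Proof.
move=> E1 E2; have d1 := super_equiv_mdeg E1; have d2 := super_equiv_mdeg E2.
case: E1 E2 => [e1 h1] [e2 h2] [d e h]; split; first by rewrite -d1 -d2.
  by move=> x; rewrite -e1 -e2.
by move=> E x; rewrite -h1 -h2; apply: h => y; rewrite e1 e2.
Qed.

Lemma super_le_anti nu eta : super_le m nu eta -> super_le m eta nu -> super_equiv nu eta.
Proof.
move=> [d e h] [d' e' h'].
have E : excess nu =1 excess eta by move=> x; apply/eqP; rewrite eqn_leq e e'.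
by split=> // x; apply/eqP; rewrite eqn_leq h // h' // => y; rewrite E.
Qed.

Lemma super_equiv_mperm eta s : (forall i, (s i < m) = (i < m)) ->
  super_equiv [multinom eta (s i) | i < N] eta.
Proof.
move=> sm; split=> x.
  rewrite !excess_mnm [RHS](reindex_inj (@perm_inj _ s)) /=.
  by apply: eq_bigr => i _; rewrite mnmE.
rewrite /headcount [RHS](reindex_inj (@perm_inj _ s)) /=.
by apply: eq_big => [i|i _]; rewrite ?sm ?mnmE.
Qed.

Lemma perm_blockI s i : perm_on (blockI N m) s -> (s i < m) = (i < m).
Proof. by move/(@perm_closed _ _ _ i); rewrite !inE. Qed.

Lemma perm_blockJ s i : perm_on (blockJ N m) s -> (s i < m) = (i < m).
Proof. by move/(@perm_closed _ _ _ i); rewrite !inE !(leqNgt m) => /negb_inj. Qed.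

Lemma disjoint_blocks : [disjoint blockI N m & blockJ N m].
Proof. by rewrite disjoints_subset; apply/subsetP => i; rewrite !inE -ltnNge. Qed.

Lemma super_equiv_blocks eta s t : perm_on (blockI N m) s -> perm_on (blockJ N m) t ->
  super_equiv [multinom [multinom eta (s i) | i < N] (t i) | i < N] eta.
Proof.
move=> sI tJ; have E := super_equiv_mperm eta (fun i => perm_blockI i sI).
by apply: super_equiv_trans E; apply: super_equiv_mperm => i; apply: perm_blockJ.
Qed.

Definition headrange a b eta x := \sum_(i < N | a <= i < b) (x <= eta i).

Lemma headcount_range a b eta x : a <= b ->
  headcount b eta x = headcount a eta x + headrange a b eta x.
Proof.
move=> ab; rewrite /headcount (bigID (fun i : 'I_N => i < a)) /=; congr (_ + _).
  by apply: eq_bigl => i; rewrite andbC; case: ltnP => // ia; apply: leq_trans ia ab.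
by apply: eq_bigl => i; rewrite -leqNgt andbC.
Qed.

Lemma headrange_le a b eta x : headrange a b eta x <= \sum_(i < N | a <= i < b) 1.
Proof. by apply: leq_sum => i _; apply: leq_b1. Qed.

Lemma headrange_all a b eta x : (forall i, a <= i < b -> x <= eta i) ->
  headrange a b eta x = \sum_(i < N | a <= i < b) 1.
Proof. by move=> H; apply: eq_bigr => i /H ->. Qed.

Lemma headrange_none a b eta x : (forall i, a <= i < b -> eta i < x) ->
  headrange a b eta x = 0.
Proof. by move=> H; apply: big1 => i /H; rewrite ltnNge => /negbTE ->. Qed.

(** Either all parts of [eta] between [a] and [k] are at least [x], and its count is as large as
    possible; or one of them is smaller, and so are all later ones up to [b], so that the count at
    [k] is already the one at [b]. *)
Lemma headcount_decreasing a b k eta nu x : a <= k <= b ->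
  (forall i j, a <= i -> i < j -> j < b -> eta j <= eta i) ->
  headcount a nu x = headcount a eta x -> headcount b nu x = headcount b eta x ->
  headcount k nu x <= headcount k eta x.
Proof.
move=> /andP[ak kb] dec Ea Eb.
case: (boolP [forall i : 'I_N, (a <= i < k) ==> (x <= eta i)]) => [/forallP all_k|].
  rewrite !(headcount_range _ _ ak) Ea leq_add2l (@headrange_all _ _ eta).
    exact: headrange_le.
  by move=> i; apply/implyP.
case/forallPn => i; rewrite negb_imply -ltnNge => /andP[/andP[ai ik] eta_i].
suff Ek : headcount k eta x = headcount b eta x.
  by rewrite Ek -Eb (headcount_range nu x kb) leq_addr.
rewrite (headcount_range _ _ kb) headrange_none ?addn0 // => j /andP[kj jb].
by apply: leq_ltn_trans eta_i; apply: dec => //; apply: leq_trans kj.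
Qed.

Lemma headcount_increasing a b k eta nu x : a <= k <= b ->
  (forall i j, a <= i -> i < j -> j < b -> eta i <= eta j) ->
  headcount a nu x = headcount a eta x -> headcount b nu x = headcount b eta x ->
  headcount k eta x <= headcount k nu x.
Proof.
move=> /andP[ak kb] inc Ea Eb.
case: (boolP [forall i : 'I_N, (k <= i < b) ==> (x <= eta i)]) => [/forallP all_k|].
  move: Eb; rewrite !(headcount_range _ _ kb) (@headrange_all _ _ eta); last first.
    by move=> i; apply/implyP.
  by have := headrange_le k b nu x; lia.
case/forallPn => i; rewrite negb_imply -ltnNge => /andP[/andP[ki ib] eta_i].
suff Ek : headcount k eta x = headcount a eta x.
  by rewrite Ek -Ea (headcount_range nu x ak) leq_addr.
rewrite (headcount_range _ _ ak) headrange_none ?addn0 // => j /andP[aj jk].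
by apply: leq_ltn_trans eta_i; apply: inc => //; apply: leq_trans ki.
Qed.

Lemma headcount0n eta x : headcount 0 eta x = 0.
Proof. exact: big_pred0. Qed.

(** The drop of the excess from [x] to [x + 1] is the number of parts larger than [x]. *)
Lemma headcount_total k eta nu x : N <= k -> excess nu =1 excess eta ->
  headcount k nu x = headcount k eta x.
Proof.
move=> Nk E; case: x => [|x]; first by rewrite !headcount0.
have tot kap : headcount k kap x.+1 + excess kap x.+1 = excess kap x.
  rewrite /headcount !excess_mnm (eq_bigl xpredT) => [|i]; last first.
    exact: leq_trans (ltn_ord i) Nk.
  by rewrite -big_split; apply: eq_bigr => i _ /=; lia.
by apply: (@addIn (excess nu x.+1)); rewrite tot E [in RHS]E tot.
Qed.

Definition weakly_increasing (K : {set 'I_N}) eta : Prop :=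
  forall i j, i \in K -> j \in K -> i < j -> eta i <= eta j.

Lemma weakly_decreasingP (K : {set 'I_N}) eta :
  weakly_decreasing K eta <->
  forall i j, i \in K -> j \in K -> i < j -> eta j <= eta i.
Proof.
split=> [/forallP H i j iK jK ij|H].
  by have /implyP/(_ iK)/forallP/(_ j)/implyP/(_ jK)/implyP/(_ ij) := H i.
apply/forallP => i; apply/implyP => iK; apply/forallP => j; apply/implyP => jK.
by apply/implyP; apply: H.
Qed.

Lemma strictly_decreasingP (K : {set 'I_N}) eta :
  strictly_decreasing K eta <->
  forall i j, i \in K -> j \in K -> i < j -> eta j < eta i.
Proof.
split=> [/forallP H i j iK jK ij|H].
  by have /implyP/(_ iK)/forallP/(_ j)/implyP/(_ jK)/implyP/(_ ij) := H i.
apply/forallP => i; apply/implyP => iK; apply/forallP => j; apply/implyP => jK.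
by apply/implyP; apply: H.
Qed.

Lemma bruhat_max nu eta :
  weakly_decreasing (blockI N m) eta -> weakly_decreasing (blockJ N m) eta ->
  super_equiv nu eta -> bruhat_le nu eta.
Proof.
move=> /weakly_decreasingP decI /weakly_decreasingP decJ E.
split=> [|x|_ k x]; first exact: super_equiv_mdeg.
  by case: E => ->.
case: E => e h; case: (leqP k m) => km.
  apply: (@headcount_decreasing 0 m); rewrite ?headcount0n ?h //.
  by move=> i j _ ij jm; apply: decI; rewrite ?inE // (ltn_trans ij).
(* The upper end [N + k] is past the last position and not below [k], so the counts there are total
   counts. *)
apply: (@headcount_decreasing m (N + k)); rewrite ?h ?(ltnW km) ?leq_addl //.
  move=> i j mi ij _; apply: decJ; rewrite ?inE //.
  exact: leq_trans (ltnW ij).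
by apply: headcount_total; rewrite ?leq_addr.
Qed.

Lemma bruhat_min nu eta :
  weakly_increasing (blockI N m) eta -> weakly_increasing (blockJ N m) eta ->
  super_equiv nu eta -> bruhat_le eta nu.
Proof.
move=> incI incJ E.
split=> [|x|_ k x]; first by rewrite (super_equiv_mdeg E).
  by case: E => ->.
case: E => e h; case: (leqP k m) => km.
  apply: (@headcount_increasing 0 m); rewrite ?headcount0n ?h //.
  by move=> i j _ ij jm; apply: incI; rewrite ?inE // (ltn_trans ij).
apply: (@headcount_increasing m (N + k)); rewrite ?h ?(ltnW km) ?leq_addl //.
  move=> i j mi ij _; apply: incJ; rewrite ?inE //.
  exact: leq_trans (ltnW ij).
by apply: headcount_total; rewrite ?leq_addr.
Qed.

(** Each of the two is the Bruhat maximum of their common class. *)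
Lemma superpartition_inj n n' L L' : superpartition m n L -> superpartition m n' L' ->
  super_equiv L L' -> L = L'.
Proof.
move=> /and3P[dI dJ _] /and3P[dI' dJ' _] E; apply: bruhat_anti; apply: bruhat_max => //.
exact: super_equiv_sym.
Qed.

Hypothesis mN : m <= N.

Lemma revI_subproof (i : 'I_N) : (if i < m then m.-1 - i else i) < N.
Proof. by have := ltn_ord i; case: (ltnP i m); lia. Qed.

Lemma revJ_subproof (i : 'I_N) : (if m <= i then N.-1 - (i - m) else i) < N.
Proof. by have := ltn_ord i; case: (leqP m i); lia. Qed.

Lemma revI_inj : injective (fun i => Ordinal (revI_subproof i)).
Proof.
apply: (@can_inj _ _ _ (fun i => Ordinal (revI_subproof i))) => i; apply: val_inj => /=.
by case: (ltnP i m) => im; case: ltnP; lia.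
Qed.

Lemma revJ_inj : injective (fun i => Ordinal (revJ_subproof i)).
Proof.
apply: (@can_inj _ _ _ (fun i => Ordinal (revJ_subproof i))) => i; apply: val_inj => /=.
by have iN := ltn_ord i; case: (leqP m i) => im; case: leqP; lia.
Qed.

Definition revI : 'S_N := perm revI_inj.
Definition revJ : 'S_N := perm revJ_inj.

Lemma revI_on : perm_on (blockI N m) revI.
Proof.
apply/subsetP => i; rewrite !inE permE; apply: contraR => im.
by apply/eqP/val_inj; rewrite /= (negbTE im).
Qed.

Lemma revJ_on : perm_on (blockJ N m) revJ.
Proof.
apply/subsetP => i; rewrite !inE permE; apply: contraR => im.
by apply/eqP/val_inj; rewrite /= (negbTE im).
Qed.

(** With the two block reversals explicit, [eta_of m L] is seen to lie in the orbit of [L], and the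
    signs of the terms that reach it can be compared. *)
Lemma eta_ofE L : eta_of m L = [multinom [multinom L (revI i) | i < N] (revJ i) | i < N].
Proof.
apply/mnmP => i; rewrite !mnmE; have iN := ltn_ord i.
have size_takeL : size (take m L) = m by rewrite size_takel ?size_mnm.
rewrite nth_cat size_rev size_takeL (mnm_nth 0) [revI _]permE [revJ _]permE /=.
case: (ltnP i m) => im; rewrite /=.
  rewrite im nth_rev size_takeL // nth_take; last by lia.
  by congr nth; lia.
rewrite nth_rev size_drop size_mnm; last by lia.
by rewrite nth_drop; case: ltnP; try lia; move=> _; congr nth; lia.
Qed.

Lemma eta_of_equiv L : super_equiv (eta_of m L) L.
Proof. by rewrite eta_ofE; apply: super_equiv_blocks; [exact: revI_on | exact: revJ_on]. Qed.

Lemma eta_of_increasingI L :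
  weakly_decreasing (blockI N m) L -> weakly_increasing (blockI N m) (eta_of m L).
Proof.
move=> /weakly_decreasingP dec i j; rewrite !inE => im jm ij.
rewrite eta_ofE !mnmE; apply: dec; rewrite ?inE ?(perm_blockI _ revI_on)
  ?(perm_blockJ _ revJ_on) //.
rewrite !permE /= (leqNgt m i) (leqNgt m j) im jm /= im jm.
by lia.
Qed.

Lemma eta_of_increasingJ L :
  weakly_decreasing (blockJ N m) L -> weakly_increasing (blockJ N m) (eta_of m L).
Proof.
move=> /weakly_decreasingP dec i j; rewrite !inE => im jm ij.
rewrite eta_ofE !mnmE; apply: dec; rewrite ?inE ?(leqNgt m) ?(perm_blockI _ revI_on)
  ?(perm_blockJ _ revJ_on) -?leqNgt //.
have iN := ltn_ord i; have jN := ltn_ord j.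
rewrite !permE /= im jm.
have outI k : k < N -> m <= k -> (N.-1 - (k - m) < m) = false by lia.
by rewrite !outI //; lia.
Qed.

End SuperpartitionOrder.

(** * Divided differences and triangular operators *)

Section DividedDifferences.

Variables (F : fieldType) (N : nat).
Implicit Types (f g r : {mpoly F[N]}) (i j p q : 'I_N) (s : 'S_N) (eta : 'X_{1..N}).

Local Notation dd := (@divided_difference F N).
Local Notation K := (@exchange F N).

Lemma msym_var s i : msym s 'X_i = 'X_(s i) :> {mpoly F[N]}.
Proof.
rewrite msymX; congr ('X_[_]); apply/mnmP => l; rewrite mnmE !mnm1E.
by rewrite -(inj_eq (@perm_inj _ s)) permKV.
Qed.

Lemma exchangeC i j f : K i j f = K j i f.
Proof. by rewrite /exchange tpermC. Qed.

Lemma exchangeK i j f : K i j (K i j f) = f.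
Proof. by rewrite /exchange -msymMm tperm2 msym1m. Qed.

Lemma exchange_msym s i j f : K (s i) (s j) (msym s f) = msym s (K i j f).
Proof. by rewrite /exchange -!msymMm -tpermJ -conjgC. Qed.

Lemma mcoeff_exchange i j f eta :
  (K i j f)@_eta = f@_[multinom eta (tperm i j l) | l < N].
Proof. by rewrite /exchange mcoeff_sym. Qed.

Lemma varB_neq0 i j : i != j -> 'X_j - 'X_i != 0 :> {mpoly F[N]}.
Proof.
move=> ij; apply/eqP => /(congr1 (mcoeff U_(j))).
rewrite mcoeffB !mcoeffXU eqxx (negbTE ij) subr0 mcoeff0 => /eqP.
by rewrite oner_eq0.
Qed.

Lemma dd_uniq i j f r : i != j -> r * ('X_j - 'X_i) = f - K i j f -> dd i j f = r.
Proof.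
move=> ij E; apply: (mulIf (varB_neq0 ij)).
by rewrite divided_differenceP E.
Qed.

Lemma dd_linear i j : i != j -> linear (dd i j).
Proof.
move=> ij a f g; apply: dd_uniq => //.
rewrite mulrDl -scalerAl !divided_differenceP /exchange msymD msymZ.
by rewrite scalerBr opprD addrACA.
Qed.

Lemma ddC i j f : i != j -> dd i j f = - dd j i f.
Proof.
move=> ij; apply: dd_uniq => //.
by rewrite mulNr -mulrN opprB divided_differenceP exchangeC.
Qed.

Lemma msym_dd s i j f : i != j -> msym s (dd i j f) = dd (s i) (s j) (msym s f).
Proof.
move=> ij; apply/esym/dd_uniq; first by rewrite (inj_eq perm_inj).
by rewrite exchange_msym -msymB -divided_differenceP msymM msymB !msym_var.
Qed.

Lemma msym_mderiv s i f : msym s f^`M(i) = (msym s f)^`M(s i).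
Proof.
apply/mpolyP => eta; rewrite mcoeff_sym !mcoeff_deriv mcoeff_sym mnmE.
suff -> : ([multinom eta (s l) | l < N] + U_(i))%MM =
          [multinom (eta + U_(s i))%MM (s l) | l < N] by [].
by apply/mnmP => l; rewrite !mnmE (inj_eq perm_inj).
Qed.

Definition transfer eta p q k : 'X_{1..N} :=
  [multinom (if i == p then eta p + k else if i == q then eta q - k else eta i)%N
  | i < N].

Lemma transfer_p eta p q k : transfer eta p q k p = (eta p + k)%N.
Proof. by rewrite mnmE eqxx. Qed.

Lemma transfer_q eta p q k : p != q -> transfer eta p q k q = (eta q - k)%N.
Proof. by move=> pq; rewrite mnmE eq_sym (negbTE pq) eqxx. Qed.

Lemma transfer_other eta p q k i : i != p -> i != q -> transfer eta p q k i = eta i.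
Proof. by move=> ip iq; rewrite mnmE (negbTE ip) (negbTE iq). Qed.

Lemma transfer0 eta p q : transfer eta p q 0 = eta.
Proof.
apply/mnmP => i; rewrite mnmE addn0 subn0.
by case: eqP => [->//|_]; case: eqP => [->|].
Qed.

Definition swap_mnm eta p q : 'X_{1..N} := [multinom eta (tperm p q i) | i < N].

Lemma swap_p eta p q : swap_mnm eta p q p = eta q.
Proof. by rewrite mnmE tpermL. Qed.

Lemma swap_q eta p q : swap_mnm eta p q q = eta p.
Proof. by rewrite mnmE tpermR. Qed.

Lemma swap_other eta p q i : i != p -> i != q -> swap_mnm eta p q i = eta i.
Proof. by move=> ip iq; rewrite mnmE tpermD // eq_sym. Qed.

Lemma swap_mnmK eta p q : swap_mnm (swap_mnm eta p q) p q = eta.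
Proof. by apply/mnmP => i; rewrite !mnmE tpermK. Qed.

Lemma exchange_mpolyX p q eta : K p q 'X_[eta] = 'X_[swap_mnm eta p q].
Proof. by rewrite /exchange msymX tpermV. Qed.

Lemma mpolyX_split p q eta (nu : 'X_{1..N}) : p != q ->
  (forall i, i != p -> i != q -> nu i = eta i) ->
  'X_[nu] = 'X_p ^+ nu p * ('X_q ^+ nu q *
     \prod_(i < N | (i != p) && (i != q)) 'X_i ^+ eta i) :> {mpoly F[N]}.
Proof.
move=> pq H; rewrite mpolyXE_id (big_pair_split _ _ pq); congr (_ * (_ * _)).
by apply: eq_bigr => i /andP[ip iq]; rewrite H.
Qed.

Lemma mul_dd_mpolyX p q eta : p != q -> (eta p < eta q)%N ->
  'X_q * dd p q 'X_[eta] = \sum_(k < eta q - eta p) 'X_[transfer eta p q k].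
Proof.
move=> pq lt; set d := (eta q - eta p)%N.
pose M : {mpoly F[N]} := \prod_(i < N | (i != p) && (i != q)) 'X_i ^+ eta i.
(* The common factor of the monomial and its exchange is pulled out; the rest is the factorization
   of ['X_q ^+ d - 'X_p ^+ d] by ['X_q - 'X_p]. *)
rewrite (@dd_uniq p q _ (M * 'X_p ^+ eta p * 'X_q ^+ eta p *
   \sum_(k < d) 'X_q ^+ (d.-1 - k) * 'X_p ^+ k)) //; last first.
  rewrite -mulrA [_ * ('X_q - _)]mulrC -subrXX exchange_mpolyX.
  rewrite (@mpolyX_split p q eta eta) // (@mpolyX_split p q eta (swap_mnm eta p q)) //;
    last by move=> i; apply: swap_other.
  rewrite swap_p swap_q -/M (_ : eta q = eta p + d)%N; last by rewrite subnKC // ltnW.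
  by rewrite !exprD; ring.
rewrite !mulr_sumr; apply: eq_bigr => k _.
rewrite (@mpolyX_split p q eta (transfer eta p q k)); [|by []|by move=> i; apply: transfer_other].
rewrite transfer_p transfer_q // -/M.
rewrite (_ : eta q - k = (eta p + (d.-1 - k)).+1)%N; last by have := ltn_ord k; lia.
by rewrite exprS !exprD; ring.
Qed.

Lemma dd_swap p q eta : p != q -> dd p q 'X_[eta] = - dd p q 'X_[swap_mnm eta p q].
Proof.
move=> pq; apply: dd_uniq => //; rewrite mulNr divided_differenceP.
by rewrite opprB -exchange_mpolyX exchangeK.
Qed.

Lemma dd_eq0 p q eta : p != q -> eta p = eta q -> dd p q 'X_[eta] = 0.
Proof.
move=> pq E; apply: dd_uniq => //; rewrite mul0r exchange_mpolyX.
have -> : swap_mnm eta p q = eta; last by rewrite subrr.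
by apply/mnmP => i; rewrite mnmE; case: tpermP => // ->.
Qed.

End DividedDifferences.

(** * Operators triangular for the Bruhat order *)

Section Triangular.

Variables (F : fieldType) (N : nat).
Implicit Types (f g : {mpoly F[N]}) (eta nu kap : 'X_{1..N}) (c : F).

(** The coefficient [c] may be zero. This makes the predicate stable under linear combinations and
    covers polynomials supported strictly below [eta]. *)
Definition leads eta c f : Prop :=
  f@_eta = c /\ forall nu, f@_nu != 0 -> bruhat_le nu eta.

Lemma leads0 eta : leads eta 0 0.
Proof. by split=> [|nu]; rewrite mcoeff0 ?eqxx. Qed.

Lemma leadsX eta : leads eta 1 'X_[eta].
Proof.
split=> [|nu]; rewrite mcoeffX ?eqxx //.
by case: (eta =P nu) => [-> _|_]; [exact: bruhat_refl | rewrite eqxx].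
Qed.

Lemma leadsX_lt eta nu : bruhat_le nu eta -> nu != eta -> leads eta 0 'X_[nu].
Proof.
move=> le ne; split=> [|kap]; rewrite mcoeffX ?(negbTE ne) //.
by case: (nu =P kap) => [<- _|_]; [exact: le | rewrite eqxx].
Qed.

Lemma leadsD eta c1 c2 f g : leads eta c1 f -> leads eta c2 g ->
  leads eta (c1 + c2) (f + g).
Proof.
move=> [<- Hf] [<- Hg]; split=> [|nu]; rewrite mcoeffD // => ne.
case: (eqVneq f@_nu 0) => [f0|/Hf //]; apply: Hg.
by move: ne; rewrite f0 add0r.
Qed.

Lemma leadsZ eta c a f : leads eta c f -> leads eta (a * c) (a *: f).
Proof.
move=> [<- Hf]; split=> [|nu]; rewrite mcoeffZ // mulf_eq0 negb_or.
by case/andP => _ /Hf.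
Qed.

Lemma leadsN eta c f : leads eta c f -> leads eta (- c) (- f).
Proof. by move/(leadsZ (-1)); rewrite mulN1r scaleN1r. Qed.

Lemma leads_sum (I : Type) (r : seq I) (P : pred I) (C : I -> F)
    (G : I -> {mpoly F[N]}) eta :
  (forall i, P i -> leads eta (C i) (G i)) ->
  leads eta (\sum_(i <- r | P i) C i) (\sum_(i <- r | P i) G i).
Proof.
move=> H; elim/big_rec2: _ => [|i c f Pi IH]; first exact: leads0.
by apply: leadsD => //; apply: H.
Qed.

Lemma leads_sum0 (I : Type) (r : seq I) (P : pred I) (G : I -> {mpoly F[N]}) eta :
  (forall i, P i -> leads eta 0 (G i)) -> leads eta 0 (\sum_(i <- r | P i) G i).
Proof. by move/(leads_sum r); rewrite big1. Qed.

Lemma linear_mpolyE (A : {mpoly F[N]} -> {mpoly F[N]}) f : linear A ->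
  A f = \sum_(kap <- msupp f) f@_kap *: A 'X_[kap].
Proof.
move=> linA; rewrite [in LHS](mpolyE f).
elim: (msupp f) => [|kap t IH]; last by rewrite !big_cons linA IH.
by rewrite !big_nil; have := linA (-1) 0 0; rewrite scaler0 addr0 scaleN1r addNr.
Qed.

Definition triangular (A : {mpoly F[N]} -> {mpoly F[N]}) (a : 'X_{1..N} -> F) : Prop :=
  linear A /\ forall eta, leads eta (a eta) (A 'X_[eta]).

(** A monomial [kap] of [f] contributes to the coefficient of [nu] only if [nu] is below [kap], and
    by maximality this leaves [nu] itself. *)
Lemma triangular_mcoeff A a f nu : triangular A a ->
  (forall kap, kap \in msupp f -> bruhat_le nu kap -> kap = nu) ->
  (A f)@_nu = a nu * f@_nu.
Proof.
move=> [linA triA] max_nu.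
rewrite (linear_mpolyE _ linA) raddf_sum /=.
case: (boolP (nu \in msupp f)) => nuf.
  rewrite (bigD1_seq nu) ?msupp_uniq //= mcoeffZ (triA nu).1 big_seq_cond.
  rewrite big1 => [|kap /andP[kf ne]]; first by rewrite addr0; apply: mulrC.
  rewrite mcoeffZ.
  apply/eqP; rewrite mulf_eq0 -[X in _ || X]negbK; apply/orP; right; apply/negP.
  by move=> /(triA kap).2 /(max_nu _ kf) E; rewrite E eqxx in ne.
rewrite big_seq big1 => [|kap kf]; first by rewrite memN_msupp_eq0 // mulr0.
rewrite mcoeffZ; apply/eqP; rewrite mulf_eq0 -[X in _ || X]negbK; apply/orP; right.
apply/negP => /(triA kap).2 /(max_nu _ kf) E.
by move: nuf; rewrite -E kf.
Qed.

Lemma triangular_leads A a eta c f : triangular A a -> leads eta c f ->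
  leads eta (a eta * c) (A f).
Proof.
move=> tA [<- Hf]; split.
  apply: triangular_mcoeff => // kap; rewrite mcoeff_msupp => /Hf k1 k2.
  exact: bruhat_anti.
case: tA => linA triA.
move=> nu; rewrite -mcoeff_msupp (linear_mpolyE _ linA) => /msupp_sum_le /flattenP[t /mapP[kap]].
rewrite filter_predT mcoeff_msupp => /Hf kf -> /msuppZ_le; rewrite mcoeff_msupp.
by move/(triA kap).2 => nk; apply: bruhat_trans nk kf.
Qed.

Lemma bruhat_maximal (r : seq 'X_{1..N}) eta : eta \in r ->
  exists nu, [/\ nu \in r, bruhat_le eta nu
    & forall kap, kap \in r -> bruhat_le nu kap -> kap = nu].
Proof.
have [n] := ubnP (size r); elim: n r eta => // n IH r eta rn eta_r.
case: (boolp.EM (forall kap, kap \in r -> bruhat_le eta kap -> kap = eta)) => [H|].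
  by exists eta; split=> //; apply: bruhat_refl.
move/boolp.existsNP => [kap] /boolp.not_implyP[kr] /boolp.not_implyP[ek ne].
(* Dropping [eta] loses no competitor: if it were above the element found, antisymmetry would make
   the two equal. *)
have ker : kap \in [seq x <- r | x != eta] by rewrite mem_filter kr andbT; apply/eqP.
case: (IH _ kap _ ker) => [|nu].
  have := count_predC (predC1 eta) r; rewrite size_filter.
  have : has (predC (predC1 eta)) r by apply/hasP; exists eta => //=; rewrite eqxx.
  rewrite has_count; move: rn.
  by move: (count _ _) (count _ _) (size r) => x y z; lia.
rewrite mem_filter => -[/andP[nue nur] knu max_nu].
exists nu; split=> // [|x xr nux]; first exact: bruhat_trans knu.
apply: max_nu => //; rewrite mem_filter xr andbT; apply: contra nue => /eqP xe.
rewrite xe in nux; apply/eqP/bruhat_anti => //.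
exact: bruhat_trans knu.
Qed.

End Triangular.

(** * Triangularity of the Cherednik operators *)

Section Cherednik.

Variables (F : fieldType) (alpha : F) (N : nat).
Implicit Types (f g : {mpoly F[N]}) (i j p q : 'I_N) (s : 'S_N) (eta nu : 'X_{1..N}).

Local Notation dd := (@divided_difference F N).
Local Notation K := (@exchange F N).
Local Notation xi := (@cherednik F N alpha).

Lemma ltn_ord_neq i j : (i < j)%N -> i != j.
Proof. by move=> ij; apply/eqP => E; rewrite E ltnn in ij. Qed.

Lemma gtn_ord_neq i j : (j < i)%N -> i != j.
Proof. by move=> ij; apply/eqP => E; rewrite E ltnn in ij. Qed.

Lemma dd_sum_linear (P : pred 'I_N) (G : 'I_N -> {mpoly F[N]}) j :
  (forall i, P i -> i != j) -> linear (fun f => \sum_(i < N | P i) G i * dd i j f).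
Proof.
move=> Pj a f g; rewrite scaler_sumr -big_split; apply: eq_bigr => i Pi /=.
by rewrite dd_linear ?Pj // mulrDr -scalerAr.
Qed.

Lemma cherednik_linear j : linear (xi j).
Proof.
have comb a (x1 x2 x y1 y2 y z1 z2 z w1 w2 w : {mpoly F[N]}) :
    x = a *: x1 + x2 -> y = a *: y1 + y2 -> z = a *: z1 + z2 -> w = a *: w1 + w2 ->
    x + y + z - w = a *: (x1 + y1 + z1 - w1) + (x2 + y2 + z2 - w2).
  move=> -> -> -> ->; rewrite !scalerDr scalerN opprD.
  by rewrite [_ + (a *: y1 + y2)]addrACA [_ + (a *: z1 + z2)]addrACA [LHS]addrACA.
move=> a f g; apply: comb.
- by rewrite mderivD mderivZ mulrDr scalerDr -scalerAr !scalerA mulrC.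
- by apply: (dd_sum_linear (fun=> 'X_j)) => i; apply: ltn_ord_neq.
- by apply: (dd_sum_linear (fun i => 'X_i)) => i; apply: gtn_ord_neq.
- by rewrite scalerDr !scalerA mulrC.
Qed.

(** If the larger part is on the right, the geometric sum starts with the monomial of [eta] itself;
    if it is on the left, the sum starts with the exchanged monomial, which is lower. All further
    terms pull the two parts together. *)
Lemma leads_mul_dd p q eta : (p < q)%N ->
  leads eta (eta p < eta q)%N%:R ('X_q * dd p q 'X_[eta] : {mpoly F[N]}).
Proof.
move=> pq; have npq := ltn_ord_neq pq.
case: (ltngtP (eta p) (eta q)) => [lt|gt|E] /=; last first.
- by rewrite dd_eq0 // mulr0; apply: leads0.
- rewrite dd_swap // mulrN mul_dd_mpolyX ?swap_p ?swap_q //.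
  rewrite -[_%:R]opprK; apply: leadsN; rewrite oppr0.
  apply: leads_sum0 => k _; have kd := ltn_ord k.
  apply: leadsX_lt.
    apply: (bruhat_pair pq); rewrite ?transfer_p ?transfer_q ?swap_p ?swap_q //.
    + by lia.
    + by move=> i ip iq; rewrite transfer_other // swap_other.
    + by case: (posnP k) => k0; [right|left]; lia.
  apply/eqP => /mnmP/(_ p); rewrite transfer_p swap_p.
  by lia.
rewrite mul_dd_mpolyX //; case def_d : (eta q - eta p)%N => [|d]; first by lia.
rewrite big_ord_recl transfer0 -[1]addr0; apply: leadsD; first exact: leadsX.
apply: leads_sum0 => k _.
have kd := ltn_ord k; rewrite lift0; apply: leadsX_lt.
  apply: (bruhat_pair pq); rewrite ?transfer_p ?transfer_q //; first by lia.
  + by move=> i ip iq; rewrite transfer_other.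
  + by left; lia.
by apply/eqP => /mnmP/(_ p); rewrite transfer_p; lia.
Qed.

Lemma card_setF (P Q : pred 'I_N) :
  #|[set i | P i && Q i]|%:R = \sum_(i < N | P i) (Q i)%:R :> F.
Proof.
rewrite -sum1_card natr_sum (eq_bigl (fun i => P i && Q i)); last by move=> i; rewrite inE.
by rewrite big_mkcondr; apply: eq_bigr => i _; case: (Q i).
Qed.

Lemma leads_cherednik j eta : leads eta (eta_bar alpha eta j) (xi j 'X_[eta]).
Proof.
pose A := \sum_(i < N | (i < j)%N) (eta i < eta j)%N%:R : F.
pose B := \sum_(i < N | (j < i)%N) - (eta j < eta i)%N%:R : F.
have -> : eta_bar alpha eta j = alpha * ((eta j)%:R * 1) + A + B - (j : nat)%:R * 1.
  (* The constant [j] counts all positions on the left. Subtracting it from [A] leaves minus the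
     number of those whose part is at least [eta j]. *)
  have jE : (j : nat)%:R = A + \sum_(i < N | (i < j)%N) (eta j <= eta i)%N%:R.
    rewrite /A -big_split /=; transitivity (\sum_(i < N | (i < j)%N) 1 : F).
      by rewrite (big_ord_narrow (ltnW (ltn_ord j))) sumr_const card_ord.
    by apply: eq_bigr => i _; case: (leqP (eta j)) => _; rewrite ?addr0 ?add0r.
  by rewrite /eta_bar /B sumrN !card_setF jE; ring.
apply: leadsD; last first.
  by apply/leadsN/leadsZ/leadsX.
apply: leadsD.
  apply: leadsD.
    apply: leadsZ; rewrite mderivX -scalerAr -mpolyXD.
    case: (posnP (eta j)) => [->|ej]; first by rewrite mul0r scale0r; apply: leads0.
    rewrite addmC submK; first exact/leadsZ/leadsX.
    by rewrite lep1mP -lt0n.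
  by apply: leads_sum => i ij; apply: leads_mul_dd.
apply: leads_sum => i ij; rewrite ddC ?gtn_ord_neq // mulrN.
exact/leadsN/leads_mul_dd.
Qed.

Lemma triangular_cherednik j : triangular (xi j) (fun eta => eta_bar alpha eta j).
Proof. by split; [exact: cherednik_linear | exact: leads_cherednik]. Qed.

Hypothesis alpha_gen :
  forall a b : nat, alpha * a%:R + b%:R = 0 -> a = 0%N /\ b = 0%N.

Lemma triangular_ham_H : triangular (ham_H alpha) (@eigen_d F N alpha).
Proof.
split=> [c f g|eta].
  rewrite /ham_H scaler_sumr -big_split; apply: eq_bigr => i _.
  by rewrite !cherednik_linear.
rewrite (eigen_dE alpha_gen); apply: leads_sum => j _; rewrite expr2.
exact: (triangular_leads (triangular_cherednik j) (leads_cherednik j eta)).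
Qed.

Lemma triangular_ham_I m : triangular (ham_I alpha m) (@eigen_e F N alpha m).
Proof.
split=> [c f g|eta].
  rewrite /ham_I scaler_sumr -big_split; apply: eq_bigr => i _.
  by rewrite !cherednik_linear.
by rewrite eigen_eE; apply: leads_sum => j _; apply: leads_cherednik.
Qed.

Lemma joint_eigenvector_leads eta f : f != 0 ->
  (forall j, xi j f = eta_bar alpha eta j *: f) -> f@_eta != 0 /\ leads eta f@_eta f.
Proof.
move=> f0 eig.
have max_eq nu : nu \in msupp f ->
    (forall kap, kap \in msupp f -> bruhat_le nu kap -> kap = nu) -> nu = eta.
  move=> nuf max_nu; apply: (eta_bar_inj alpha_gen) => j.
  have := triangular_mcoeff (triangular_cherednik j) max_nu.
  by rewrite eig mcoeffZ => /mulIf -> //; rewrite -mcoeff_msupp.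
have [kap kf] : exists kap, kap \in msupp f.
  case E : (msupp f) => [|kap t]; last by exists kap; rewrite inE eqxx.
  by move: f0; rewrite -msupp_eq0 E.
split; last split=> // nu.
  have [nu [nuf _ max_nu]] := bruhat_maximal kf.
  by rewrite -mcoeff_msupp -(max_eq nu).
rewrite -mcoeff_msupp => /bruhat_maximal[mu [muf nu_mu max_mu]].
by rewrite -(max_eq mu).
Qed.

End Cherednik.

(** * Construction of joint eigenvectors *)

Section Hecke.

Variables (F : fieldType) (alpha : F) (N : nat).
Implicit Types (f g : {mpoly F[N]}) (i j k l : 'I_N) (s : 'S_N) (eta nu : 'X_{1..N}).

Local Notation dd := (@divided_difference F N).
Local Notation K := (@exchange F N).
Local Notation xi := (@cherednik F N alpha).

(* The S_N-equivariant part of [xi_j]. *)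
Definition dunkl j f : {mpoly F[N]} :=
  alpha *: ('X_j * f^`M(j)) + \sum_(i < N | i != j) 'X_i * dd i j f.

(** For [i < j], replacing the factor ['X_j] by ['X_i] costs [f - exchange i j f]; the [j] copies of
    [f] cancel the constant term of the operator. *)
Lemma cherednikE j f : xi j f = dunkl j f - \sum_(i < N | (i < j)%N) K i j f.
Proof.
have -> : dunkl j f = alpha *: ('X_j * f^`M(j)) +
    (\sum_(i < N | (i < j)%N) 'X_i * dd i j f + \sum_(i < N | (j < i)%N) 'X_i * dd i j f).
  rewrite /dunkl (bigID (fun i : 'I_N => (i < j)%N)) /=; congr (_ + (_ + _)).
    by apply: eq_bigl => i; rewrite andbC; case: ltnP => // /ltn_ord_neq ->.
  by apply: eq_bigl => i; rewrite -leqNgt [in RHS]ltn_neqAle eq_sym.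
rewrite /cherednik; have -> : \sum_(i < N | (i < j)%N) 'X_j * dd i j f =
    \sum_(i < N | (i < j)%N) 'X_i * dd i j f + (j : nat)%:R *: f -
    \sum_(i < N | (i < j)%N) K i j f.
  have -> : (j : nat)%:R *: f = \sum_(i < N | (i < j)%N) f.
    by rewrite (big_ord_narrow (ltnW (ltn_ord j))) sumr_const card_ord scaler_nat.
  rewrite -big_split -sumrB; apply: eq_bigr => i ij /=.
  by rewrite -addrA -divided_differenceP; ring.
by move: (alpha *: _) (_ *: f) (\sum_(i < N | _) K i j f) => x y z; ring.
Qed.

Lemma msym_dunkl s j f : msym s (dunkl j f) = dunkl (s j) (msym s f).
Proof.
rewrite /dunkl msymD msymZ msymM msym_var msym_mderiv; congr (_ + _).
rewrite [RHS](reindex_inj (@perm_inj _ s)) raddf_sum /=.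
apply: eq_big => [i|i ij]; first by rewrite (inj_eq perm_inj).
by rewrite msymM msym_var msym_dd.
Qed.

Lemma adjacent_neq k l : l = k.+1 :> nat -> k != l.
Proof. by move=> kl; apply/eqP => E; move: kl; rewrite E; lia. Qed.

Lemma tperm_adjacent_lt k l i j : l = k.+1 :> nat -> j != k -> j != l ->
  (tperm k l i < j)%N = (i < j)%N.
Proof.
move=> kl jk jl; have jk' : (j : nat) != k by []; have jl' : (j : nat) != l by [].
by case: tpermP => [->|->|//]; lia.
Qed.

(** A relation of the degenerate affine Hecke algebra. By equivariance of [dunkl], the two sides
    differ by the exchange of [k] and [l] itself, present in the operator of index [l] only; applied
    to [exchange k l f] it gives [f]. *)
Lemma cherednik_exchange k l f : l = k.+1 :> nat -> K k l (xi k f) = xi l (K k l f) + f.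
Proof.
move=> kl; have nkl := adjacent_neq kl.
rewrite !cherednikE [K k l (_ - _)]msymB msym_dunkl tpermL -[RHS]addrA; congr (_ + _).
rewrite [in RHS](bigD1 k) ?kl //= exchangeK opprD addrAC addNr add0r; congr (- _).
rewrite raddf_sum /=; apply: eq_big => [i|i ik].
  by rewrite ltnS ltn_neqAle andbC.
rewrite -[LHS]exchange_msym tpermL tpermD //; first by rewrite gtn_ord_neq.
by rewrite gtn_ord_neq // kl ltnS ltnW.
Qed.

Lemma cherednik_exchange_r k l f :
  l = k.+1 :> nat -> K k l (xi l f) = xi k (K k l f) - f.
Proof.
move=> kl; have := cherednik_exchange (K k l f) kl.
rewrite exchangeK => /(congr1 (K k l)); rewrite exchangeK => ->.
by rewrite /exchange msymD -!/(K _ _ _) exchangeK addrK.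
Qed.

Lemma cherednik_exchange_other k l j f : l = k.+1 :> nat -> j != k -> j != l ->
  K k l (xi j f) = xi j (K k l f).
Proof.
move=> kl jk jl; have sj : tperm k l j = j by rewrite tpermD // eq_sym.
rewrite !cherednikE [K k l (_ - _)]msymB msym_dunkl sj; congr (_ - _).
rewrite raddf_sum [RHS](reindex_inj (@perm_inj _ (tperm k l))) /=.
apply: eq_big => [i|i ij]; first by rewrite tperm_adjacent_lt.
by rewrite -[LHS]exchange_msym sj.
Qed.

Lemma mderiv_var k l : ('X_l : {mpoly F[N]})^`M(k) = (l == k)%:R.
Proof.
rewrite mderivX mnm1E; case: eqP => [->|_]; last by rewrite scale0r.
rewrite scale1r (_ : (U_(k) - U_(k))%MM = 0%MM) ?mpolyX0 //.
by apply/mnmP => i; rewrite mnmBE subnn mnm0E.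
Qed.

(** Among the divided differences only that of [l] and [j] fails to commute with ['X_l]. The
    resulting exchange term is the one that [raise] needs. *)
Lemma dunkl_mul_other j l g : j != l ->
  dunkl j ('X_l * g) = 'X_l * dunkl j g - 'X_l * K l j g.
Proof.
move=> jl; have lj : l != j by rewrite eq_sym.
rewrite /dunkl mderivM mderiv_var (negbTE lj) mul0r add0r mulrDr -addrA.
congr (_ + _); first by rewrite -scalerAr mulrCA.
rewrite (bigD1 l) //= [in RHS](bigD1 l) //=.
have -> : dd l j ('X_l * g) = 'X_l * dd l j g - K l j g.
  apply: dd_uniq => //; rewrite /exchange msymM msym_var tpermL -/(K l j g).
  by rewrite mulrBl -mulrA divided_differenceP; ring.
rewrite (eq_bigr (fun i => 'X_l * ('X_i * dd i j g))); last first.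
  move=> i /andP[ij il]; have -> : dd i j ('X_l * g) = 'X_l * dd i j g.
    apply: dd_uniq => //; rewrite -mulrA divided_differenceP /exchange msymM.
    by rewrite msym_var tpermD // ?mulrBr // eq_sym.
  by rewrite mulrCA.
by rewrite -mulr_sumr; ring.
Qed.

Lemma dunkl_mul_same j g :
  dunkl j ('X_j * g) =
  alpha *: ('X_j * g) + 'X_j * dunkl j g + \sum_(i < N | i != j) K i j ('X_j * g).
Proof.
rewrite /dunkl mderivM mderiv_var eqxx mul1r mulrDr scalerDr mulrDr -!addrA.
congr (_ + (_ + _)); first by rewrite -scalerAr.
rewrite mulr_sumr -big_split; apply: eq_bigr => i ij /=.
have -> : dd i j ('X_j * g) = 'X_j * dd i j g + K i j g.
  apply: dd_uniq => //; rewrite /exchange msymM msym_var tpermR -/(K i j g).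
  by rewrite mulrDl -mulrA divided_differenceP; ring.
rewrite [K i j ('X_j * g)]msymM msym_var tpermR -/(K i j g).
by rewrite mulrDr mulrCA.
Qed.

Lemma rank_perm s eta nu :
  (forall i j, before nu (s i) (s j) = before eta i j) ->
  forall j, rank nu (s j) = rank eta j :> nat.
Proof.
move=> H j; transitivity #|s @: [set i | before eta i j]|; last first.
  exact: card_imset perm_inj.
apply: eq_card => i; rewrite inE.
apply/idP/imsetP => [b|[k]]; last by rewrite inE => b ->; rewrite H.
by exists ((s^-1)%g i); rewrite ?permKV // inE -H permKV.
Qed.

(** No position lies between neighbours, so their exchange only relabels the ranks. The parts must
    differ, since a tie is broken by position and would not follow the relabelling. *)
Lemma eta_bar_swap k l eta : l = k.+1 :> nat -> eta k <> eta l ->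
  forall j, eta_bar alpha (swap_mnm eta k l) (tperm k l j) = eta_bar alpha eta j.
Proof.
move=> kl ne j; rewrite !eta_barE mnmE tpermK; congr (_ - _%:R).
apply: rank_perm => {}j i; rewrite /before !mnmE !tpermK.
have nat_neq (x y : 'I_N) : x <> y -> (x : nat) != y by move/eqP.
case: (tpermP k l j) => [->|->|/nat_neq jk /nat_neq jl];
  case: (tpermP k l i) => [->|->|/nat_neq ik /nat_neq il]; lia.
Qed.

Hypothesis alpha_gen :
  forall a b : nat, alpha * a%:R + b%:R = 0 -> a = 0%N /\ b = 0%N.

Definition joint_eigenvector eta f : Prop :=
  f != 0 /\ forall j, xi j f = eta_bar alpha eta j *: f.

Lemma joint_eigenvector_swap k l eta f : l = k.+1 :> nat -> (eta k < eta l)%N ->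
  joint_eigenvector eta f -> exists g, joint_eigenvector (swap_mnm eta k l) g.
Proof.
move=> kl lt [f0 eig]; have nkl := adjacent_neq kl.
have kl_lt : (k < l)%N by rewrite kl.
pose ek := eta_bar alpha eta k; pose el := eta_bar alpha eta l.
(* Position [l] comes before [k], so the difference is [alpha * a + b] with [a] and [b] positive
   naturals. *)
have dne : el - ek != 0.
  apply/eqP; rewrite /el /ek !eta_barE => E.
  have := rank_lt (_ : before eta l k); rewrite /before kl_lt lt orbT => /(_ isT) rlk.
  have [] := @alpha_gen (eta l - eta k) (rank eta k - rank eta l); last by lia.
  by rewrite !natrB ?(ltnW lt) ?(ltnW rlk) // -[RHS]E; ring.
(* On the span of [f] and [exchange k l f] the two operators are triangular, with diagonal entries
   [ek] and [el] and off-diagonal entries 1 and -1. This [a] diagonalizes both. *)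
pose a := (el - ek)^-1; exists (a *: f + K k l f).
have a_eq : a * el - 1 = a * ek.
  by apply/eqP; rewrite subr_eq addrC -subr_eq -mulrBr mulVf.
have fE : (a * ek) *: f + f = (a * el) *: f by rewrite -a_eq scalerBl scale1r subrK.
split.
  (* The exchanged exponent is strictly above [eta], hence absent from [f]; the coefficient there is
     that of [eta] in [f], which is nonzero. *)
  apply/eqP => /(congr1 (mcoeff (swap_mnm eta k l))).
  rewrite mcoeffD mcoeffZ mcoeff0 mcoeff_exchange -/(swap_mnm _ _ _) swap_mnmK.
  have [fe [_ supp_f]] := joint_eigenvector_leads alpha_gen f0 eig.
  have -> : f@_(swap_mnm eta k l) = 0.
    apply/eqP; apply/negPn/negP => /supp_f le.
    have le' : bruhat_le eta (swap_mnm eta k l).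
      apply: (bruhat_pair kl_lt); rewrite ?swap_p ?swap_q ?(addnC (eta l)) //.
        by move=> i ik il; rewrite swap_other.
      by right; split; rewrite // ltnW.
    have /mnmP/(_ k) := bruhat_anti le' le; rewrite swap_p.
    by lia.
  by rewrite mulr0 add0r; apply/eqP.
move=> j; rewrite -[j in eta_bar _ _ j](tpermK k l) eta_bar_swap //; last by lia.
rewrite cherednik_linear eig.
case: (tpermP k l j) => [->|->|/eqP jk /eqP jl]; rewrite -/ek -/el.
- have := cherednik_exchange_r f kl; rewrite eig => /eqP.
  rewrite eq_sym subr_eq => /eqP ->; rewrite /exchange msymZ -/(K k l f) -/el.
  by rewrite scalerDr !scalerA addrCA fE addrC [a * el]mulrC.
- have := cherednik_exchange f kl; rewrite eig => /eqP.
  rewrite -subr_eq eq_sym => /eqP ->; rewrite /exchange msymZ -/(K k l f) -/ek.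
  by rewrite scalerDr !scalerA addrCA -fE addrK addrC [a * ek]mulrC.
- rewrite -cherednik_exchange_other // eig /exchange msymZ scalerDr !scalerA.
  by rewrite [a * _]mulrC.
Qed.

End Hecke.

(** * The raising operator and the recursion on compositions *)

Section Raising.

Variables (F : fieldType) (alpha : F) (n : nat).
Implicit Types (f g : {mpoly F[n.+1]}) (i j : 'I_n.+1) (eta nu : 'X_{1..n.+1}).

Local Notation K := (@exchange F n.+1).
Local Notation xi := (@cherednik F n.+1 alpha).

Hypothesis alpha_gen :
  forall a b : nat, alpha * a%:R + b%:R = 0 -> a = 0%N /\ b = 0%N.

(** [ord_pred] wraps around: position 0 goes to the end and every other position moves down by
    one. *)
Definition cyc : 'S_n.+1 := perm (@ord_pred_inj n.+1).

Lemma cyc0 : cyc ord0 = ord_max.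
Proof. by apply: val_inj; rewrite permE /= modn_small. Qed.

Lemma ord_gt0 j : j != ord0 -> (0 < j)%N.
Proof. by move=> j0; rewrite lt0n; apply: contra j0 => /eqP E; apply/eqP/val_inj. Qed.

Lemma val_cyc j : j != ord0 -> cyc j = j.-1 :> nat.
Proof.
move=> j0; rewrite permE /=; have jn := ltn_ord j.
have jp := ord_gt0 j0.
by rewrite (_ : (j + n.+1).-1 = j.-1 + n.+1)%N ?modnDr ?modn_small //; lia.
Qed.

Lemma cyc_lt i j : j != ord0 -> (cyc i < cyc j)%N = (i != ord0) && (i < j)%N.
Proof.
move=> j0; have jn := ltn_ord j; case: (eqVneq i ord0) => [->|i0] /=.
  by rewrite cyc0 (val_cyc j0) /=; lia.
by rewrite !val_cyc //; have := ord_gt0 i0; have := ord_gt0 j0; lia.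
Qed.

Definition raise f : {mpoly F[n.+1]} := 'X_ord_max * msym cyc f.

Lemma raise_neq0 f : f != 0 -> raise f != 0.
Proof.
move=> f0; rewrite mulf_neq0 //; last first.
  by apply: contra f0 => /eqP E; apply/eqP/(@inj_msym _ _ cyc); rewrite E msym0.
by apply/eqP => /(congr1 (mcoeff U_(ord_max))) /eqP; rewrite mcoeffXU eqxx mcoeff0 oner_eq0.
Qed.

(** The exchange with position 0, which precedes [j], becomes an exchange with the last position,
    which no longer precedes [cyc j]. The missing term is the correction in [dunkl_mul_other]. *)
Lemma cherednik_raise j f : j != ord0 -> xi (cyc j) (raise f) = raise (xi j f).
Proof.
move=> j0; have cj : cyc j != ord_max by rewrite -cyc0 (inj_eq perm_inj).
have cj_lt := ltn_ord (cyc j).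
rewrite /raise !cherednikE dunkl_mul_other // msymB msym_dunkl mulrBr -addrA.
congr (_ + _); rewrite -opprD; congr (- _).
rewrite [msym _ (\sum_(i < _ | _) _)]raddf_sum [in RHS](bigD1 ord0) ?ord_gt0 //=.
rewrite -exchange_msym cyc0 mulrDr; congr (_ + _).
rewrite [RHS]mulr_sumr (reindex_inj (@perm_inj _ cyc)) /=.
apply: eq_big => [i|i]; first by rewrite cyc_lt // andbC.
rewrite cyc_lt // => /andP[i0 ij]; rewrite -exchange_msym.
rewrite [LHS]msymM msym_var tpermD //; first by rewrite -cyc0 (inj_eq perm_inj).
Qed.

(** Position 0 has no exchange terms and the last position has all of them; they cancel the sum
    created by [dunkl_mul_same], and only the derivative of the new factor remains. *)
Lemma cherednik_raise0 f :
  xi ord_max (raise f) = raise (xi ord0 f) + alpha *: raise f.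
Proof.
rewrite /raise !cherednikE dunkl_mul_same [\sum_(i < _ | (i < ord0)%N) _]big1 //.
rewrite subr0 msym_dunkl cyc0 [alpha *: _ + _]addrC.
set S := \sum_(i < _ | (i < _)%N) _; set S' := \sum_(i < _ | _) _.
suff -> : S' = S by rewrite addrK.
by apply: eq_bigl => i; rewrite ltn_neqAle -ltnS ltn_ord andbT.
Qed.

Definition raise_mnm eta : 'X_{1..n.+1} :=
  [multinom (eta ((cyc^-1)%g i) + (i == ord_max))%N | i < n.+1].

Lemma raise_mnm_cyc eta j : raise_mnm eta (cyc j) = (eta j + (j == ord0))%N.
Proof. by rewrite mnmE permK -cyc0 (inj_eq perm_inj). Qed.

(** The first part wins every tie. Moved to the end it would lose them all, and the added one
    compensates exactly. *)
Lemma rank_raise eta j : rank (raise_mnm eta) (cyc j) = rank eta j :> nat.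
Proof.
apply: rank_perm => {}j i; rewrite /before !raise_mnm_cyc.
case: (eqVneq i ord0) => [->|i0]; case: (eqVneq j ord0) => [->|j0].
- by rewrite !ltnn.
- have := ord_gt0 j0; have := ltn_ord j; rewrite cyc0 (val_cyc j0) /=; lia.
- have := ord_gt0 i0; have := ltn_ord i; rewrite cyc0 (val_cyc i0) /=; lia.
- by rewrite !cyc_lt // i0 j0 /= !addn0.
Qed.

Lemma joint_eigenvector_raise eta f : joint_eigenvector alpha eta f ->
  joint_eigenvector alpha (raise_mnm eta) (raise f).
Proof.
move=> [f0 eig]; split; first exact: raise_neq0.
move=> k; rewrite -[k](permKV cyc); move: ((cyc^-1)%g k) => j.
have raiseZ c : raise (c *: f) = c *: raise f by rewrite /raise msymZ scalerAr.
rewrite !eta_barE raise_mnm_cyc rank_raise.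
case: (eqVneq j ord0) => [->|j0].
  rewrite cyc0 cherednik_raise0 eig raiseZ -scalerDl eta_barE natrD.
  by congr (_ *: _); rewrite mulrDr mulr1 addrAC.
by rewrite cherednik_raise // eig raiseZ addn0 eta_barE.
Qed.

(** Induction on the degree, and inside it on the distance of the last nonzero part from the end: at
    distance zero the composition is raised from a lower degree, otherwise that part is moved one
    place to the right. *)
Lemma joint_eigenvector_exists eta : exists f, joint_eigenvector alpha eta f.
Proof.
move: {2}(mdeg eta) (erefl (mdeg eta)) => d; elim: d eta => [|d IHd] eta deg_eta.
  have -> : eta = 0%MM by apply/eqP; rewrite -mdeg_eq0 deg_eta.
  exists 'X_[0%MM]; split=> [|j].
    apply/eqP => /(congr1 (mcoeff 0%MM)) /eqP.
    by rewrite mcoeffX eqxx mcoeff0 oner_eq0.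
  (* The zero composition is the only one of degree zero, so triangularity alone makes the constant
     an eigenvector. *)
  have [c0 supp_xi] := leads_cherednik alpha j (0%MM : 'X_{1..n.+1}).
  apply/mpolyP => nu; rewrite mcoeffZ mcoeffX eq_sym.
  case: (eqVneq nu 0%MM) => [->|nu0]; first by rewrite c0 mulr1.
  rewrite mulr0; apply/eqP; apply/negPn/negP => /supp_xi[].
  by rewrite mdeg0 => /eqP; rewrite mdeg_eq0 (negbTE nu0).
suff descend k : (k <= n)%N -> forall nu, mdeg nu = d.+1 ->
    nu (inord (n - k)) != 0%N -> (forall i : 'I_n.+1, (n - k < i)%N -> nu i = 0%N) ->
    exists f, joint_eigenvector alpha nu f.
  have [i ei] : exists i, eta i != 0%N.
    apply/existsP; rewrite -negb_forall; apply/negP => /forallP eta0.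
    by move: deg_eta; rewrite mdegE big1 // => i _; apply/eqP.
  have [j ej maxj] : exists2 j, eta j != 0%N & forall i, eta i != 0%N -> (i <= j)%N.
    by case: (@arg_maxnP _ i (fun i => eta i != 0%N) (fun i => i : nat)) => // j; exists j.
  have jn : (j <= n)%N by rewrite -ltnS.
  apply: (@descend (n - j)%N); rewrite ?leq_subr ?subKn ?inord_val // => k jk.
  by apply/eqP/negPn/negP => /maxj; rewrite leqNgt jk.
elim: k => [|k IHk] kn nu deg_nu nuk zero.
  rewrite subn0 in nuk.
  have maxE : inord n = ord_max :> 'I_n.+1 by apply: val_inj; rewrite /= inordK.
  rewrite maxE in nuk.
  (* The preimage of [nu] under [raise_mnm]; the truncated subtraction is exact because the last
     part of [nu] is nonzero. *)
  pose eta' : 'X_{1..n.+1} := [multinom (nu (cyc i) - (i == ord0))%N | i < n.+1].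
  have nuE : nu = raise_mnm eta'.
    apply/mnmP => k; rewrite -[k](permKV cyc) raise_mnm_cyc mnmE.
    by case: eqP => [->|_]; rewrite ?cyc0 ?subn0 ?addn0 // subnK // lt0n.
  have [|f ef] := IHd eta'.
    move: deg_nu; rewrite nuE !mdegE (reindex_inj (@perm_inj _ cyc)) /=.
    under eq_bigr do rewrite raise_mnm_cyc.
    rewrite big_split /= [X in (_ + X)%N](bigD1 ord0) //= [X in (_ + (_ + X))%N]big1.
      by rewrite addn0 addn1; case.
    by move=> i /negbTE ->.
  by exists (raise f); rewrite nuE; apply: joint_eigenvector_raise.
have pn : (n - k.+1 < n.+1)%N by lia.
have qn : (n - k < n.+1)%N by lia.
pose p := Ordinal pn; pose q := Ordinal qn.
have pE : inord (n - k.+1) = p by apply: val_inj; rewrite /= inordK.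
have qE : inord (n - k) = q by apply: val_inj; rewrite /= inordK.
rewrite pE in nuk.
have nuq : nu q = 0%N by apply: zero => /=; lia.
have qp : q = p.+1 :> nat by rewrite /=; lia.
have [| | |f ef] := IHk (ltnW kn) (swap_mnm nu p q).
- by rewrite mdeg_mperm.
- by rewrite qE swap_q.
- move=> i lt_i; have ip : i != p by apply: gtn_ord_neq => /=; lia.
  by rewrite swap_other ?zero //; [lia | apply: gtn_ord_neq].
(* The exchanged composition has a zero followed by a nonzero part, which is the increasing pair
   needed to exchange back. *)
rewrite -(swap_mnmK nu p q); apply: joint_eigenvector_swap ef => //.
by rewrite swap_p swap_q nuq lt0n.
Qed.

End Raising.

(** * Monomials and symmetrization with prescribed symmetry *)

Section BlockMonomials.

Variables (F : fieldType) (N : nat).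
Implicit Types (p q : {mpoly F[N]}) (K : {set 'I_N}) (L kap nu : 'X_{1..N}).
Implicit Types (b : bool) (s t u : 'S_N).

Local Notation "L # s" := [multinom L ((s : 'S_N) i) | i < N]
  (at level 40, left associativity).

(** The sign character or the trivial one, so that the four symmetry types are handled by two
    booleans. *)
Definition sgnb b s : F := if b then (-1) ^+ s else 1.

Lemma sgnbM b s t : sgnb b (s * t)%g = sgnb b s * sgnb b t.
Proof. by case: b => /=; rewrite ?mulr1 // odd_permM signr_addb. Qed.

Lemma sgnb_sqr b s : sgnb b s * sgnb b s = 1.
Proof. by case: b => /=; rewrite ?mulr1 // -expr2 sqrr_sign. Qed.

Lemma sgnb_neq0 b s : sgnb b s != 0.
Proof. by case: b => /=; rewrite ?signr_eq0 ?oner_eq0. Qed.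

Lemma perm_on_mulr K s t : perm_on K s -> perm_on K (t * s)%g = perm_on K t.
Proof.
move=> sK; apply/idP/idP => [tsK|tK]; last exact: perm_onM.
by rewrite -[t](mulgK s); apply: perm_onM => //; apply: perm_onV.
Qed.

Lemma perm_on_fix K K' s i : [disjoint K & K'] -> perm_on K' s -> i \in K -> s i = i.
Proof. by move=> dis sK' iK; apply: out_perm sK' _; rewrite (disjointFr dis). Qed.

Definition restr K L : 'X_{1..N} := [multinom (if i \in K then L i else 0)%N | i < N].

Definition block_monomial b K L : {mpoly F[N]} :=
  if b then alt_monomial F K L else sym_monomial F K L.

Lemma alt_term K L s : perm_on K s ->
  \prod_(i in K) 'X_(s i) ^+ L i = 'X_[restr K (L # s^-1%g)] :> {mpoly F[N]}.
Proof.
move=> sK; rewrite (mpolyXE F s) big_mkcond; apply: eq_bigr => i _ /=.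
by rewrite mnmE perm_closed //; case: ifP; rewrite ?mnmE ?permK.
Qed.

Lemma mcoeff_sum_uniq (r : seq 'X_{1..N}) kap : uniq r ->
  (\sum_(nu <- r) 'X_[nu] : {mpoly F[N]})@_kap = (kap \in r)%:R.
Proof.
move=> ur; rewrite raddf_sum /=; under eq_bigr do rewrite mcoeffX.
case: (boolP (kap \in r)) => kr.
  by rewrite (bigD1_seq kap) //= eqxx big1 ?addr0 // => nu /negbTE ->.
rewrite big_seq big1 // => nu nur; case: eqP => // E.
by rewrite -E nur in kr.
Qed.

Lemma mcoeff_sym_monomial K L kap : (sym_monomial F K L)@_kap =
  [exists s : 'S_N, perm_on K s && (kap == restr K (L # s))]%:R.
Proof.
rewrite mcoeff_sum_uniq ?undup_uniq // mem_undup; congr (_%:R); congr (nat_of_bool _).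
have E s : [multinom (if i \in K then L (s i) else 0)%N | i < N] = restr K (L # s).
  by apply/mnmP => i; rewrite !mnmE.
apply/mapP/existsP => [[s]|[s /andP[sK /eqP ->]]].
  by rewrite mem_enum => sK ->; exists s; rewrite E eqxx andbT.
by exists s; rewrite ?mem_enum ?E.
Qed.

Lemma block_monomial_supp b K L kap : (block_monomial b K L)@_kap != 0 ->
  exists2 s, perm_on K s & kap = restr K (L # s).
Proof.
case: b => /=; last first.
  rewrite mcoeff_sym_monomial; case: existsP => [[s /andP[sK /eqP ->]] _|_].
    by exists s.
  by rewrite eqxx.
case: (pickP (fun s : 'S_N => perm_on K s && (kap == restr K (L # s^-1%g)))).
  by move=> s /andP[sK /eqP ->] _; exists (s^-1)%g => //; apply: perm_onV.
move=> none; rewrite /alt_monomial raddf_sum big1 ?eqxx // => s sK /=.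
rewrite mcoeffZ alt_term // mcoeffX; have := none s; rewrite sK /= eq_sym => ->.
by rewrite mulr0.
Qed.

Lemma block_monomial_out b K L kap i : (block_monomial b K L)@_kap != 0 ->
  i \notin K -> kap i = 0%N.
Proof. by case/block_monomial_supp => s _ -> iK; rewrite mnmE (negbTE iK). Qed.

Lemma block_monomial_sym b K L s : perm_on K s ->
  msym s (block_monomial b K L) = sgnb b s *: block_monomial b K L.
Proof.
move=> sK; case: b => /=; last first.
  rewrite scale1r; apply/mpolyP => kap; rewrite mcoeff_sym !mcoeff_sym_monomial.
  congr (_%:R); congr (nat_of_bool _).
  apply/existsP/existsP => -[t /andP[tK /eqP E]].
    exists (s^-1 * t)%g; rewrite perm_onM ?perm_onV //=; apply/eqP/mnmP => i.
    have /mnmP/(_ ((s^-1)%g i)) := E; rewrite !mnmE permKV permM => ->.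
    by rewrite perm_closed // perm_onV.
  exists (s * t)%g; rewrite perm_onM //=; apply/eqP/mnmP => i.
  by rewrite E !mnmE perm_closed // permM.
rewrite /alt_monomial raddf_sum scaler_sumr [RHS](reindex_inj (mulIg s)) /=.
apply: eq_big => [t|t tK]; first by rewrite perm_on_mulr.
rewrite scalerA odd_permM signr_addb mulrCA -expr2 sqrr_sign mulr1 msymZ.
congr (_ *: _); rewrite rmorph_prod /=; apply: eq_bigr => i _.
by rewrite rmorphXn /= msym_var permM.
Qed.

(** An exponent that vanishes outside [K] has only zeros at the positions of [K'], so permuting
    these does not change it. *)
Lemma msym_fixed K K' p s :
  [disjoint K & K'] -> (forall kap i, p@_kap != 0 -> i \notin K -> kap i = 0%N) ->
  perm_on K' s -> msym s p = p.
Proof.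
move=> dis out sK'.
have fix_kap kap t : perm_on K' t -> p@_kap != 0 -> kap # t = kap.
  move=> tK' pk; apply/mnmP => i; rewrite mnmE; case: (boolP (i \in K)) => iK.
    by rewrite (perm_on_fix dis tK').
  rewrite !(out _ _ pk) //; apply: contra iK => tiK.
  by have := perm_on_fix dis tK' tiK => /perm_inj E; rewrite E in tiK.
apply/mpolyP => kap; rewrite mcoeff_sym.
case: (eqVneq p@_kap 0) => [k0|/(fix_kap _ _ sK') -> //].
rewrite k0; apply/eqP; apply/negPn/negP => ks.
have := fix_kap _ _ (perm_onV sK') ks; rewrite mpermKV => E.
by move: ks; rewrite -E k0 eqxx.
Qed.

Lemma mcoeff_mul_blocks K p q kap :
  (forall nu i, p@_nu != 0 -> i \notin K -> nu i = 0%N) ->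
  (forall nu i, q@_nu != 0 -> i \in K -> nu i = 0%N) ->
  (p * q)@_kap = p@_(restr K kap) * q@_(restr (~: K) kap).
Proof.
move=> outp outq; rewrite mcoeffM.
have splitk : kap = (restr K kap + restr (~: K) kap)%MM.
  by apply/mnmP => i; rewrite !mnmE inE; case: (i \in K); rewrite ?addn0.
have d1 : (mdeg (restr K kap) < (mdeg kap).+1)%N by rewrite ltnS splitk mdegD -splitk leq_addr.
have d2 : (mdeg (restr (~: K) kap) < (mdeg kap).+1)%N.
  by rewrite ltnS {2}splitk mdegD leq_addl.
rewrite (bigD1 (BMultinom d1, BMultinom d2)) /=; last by rewrite -splitk.
rewrite big1 ?addr0 // => -[k1 k2] /andP[/eqP /= kE ne].
case: (eqVneq p@_k1 0) => [->|p1]; first by rewrite mul0r.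
case: (eqVneq q@_k2 0) => [->|q2]; first by rewrite mulr0.
have kapE i : kap i = (k1 i + k2 i)%N by move/mnmP: kE => ->; rewrite mnmDE.
case/negP: ne; apply/eqP; congr (_, _); apply: val_inj; apply/mnmP => i /=;
  rewrite mnmE ?inE kapE; case: (boolP (i \in K)) => iK /=.
- by rewrite (outq _ _ q2) ?addn0.
- by rewrite (outp _ _ p1).
- by rewrite (outq _ _ q2).
- by rewrite (outp _ _ p1).
Qed.

Lemma strictly_decreasing_inj K L i j : strictly_decreasing K L ->
  i \in K -> j \in K -> L i = L j -> i = j.
Proof.
move=> /strictly_decreasingP dec iK jK E; apply: val_inj.
case: (ltngtP i j) => // ij; [have := dec _ _ iK jK ij | have := dec _ _ jK iK ij];
  by rewrite E ltnn.
Qed.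

(** In the alternating case strict decrease makes the exponents distinct, so only the identity
    reaches this monomial; in the symmetric case repeated monomials have been removed. *)
Lemma block_monomial_diag b K L : (b -> strictly_decreasing K L) ->
  (block_monomial b K L)@_(restr K L) = 1.
Proof.
case: b => /= [/(_ isT) dec|_]; last first.
  rewrite mcoeff_sym_monomial; case: existsP => // -[]; exists 1%g.
  rewrite perm_on1 /=; apply/eqP; congr (restr _ _).
  by apply/mnmP => i; rewrite mnmE perm1.
rewrite /alt_monomial raddf_sum (bigD1 1%g) ?perm_on1 //= [X in _ + X]big1 => [|s /andP[sK s1]].
  rewrite addr0 odd_perm1 expr0 scale1r alt_term ?perm_on1 // mcoeffX invg1.
  rewrite (_ : L # 1%g = L) ?eqxx //.
  by apply/mnmP => i; rewrite mnmE perm1.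
rewrite mcoeffZ alt_term // mcoeffX; case: eqP => [E|_]; last by rewrite mulr0.
case/eqP: s1; apply/permP => i; rewrite perm1.
case: (boolP (i \in K)) => iK; last exact: out_perm sK iK.
apply/esym; have /mnmP/(_ (s i)) := E; rewrite !mnmE permK perm_closed // iK.
by apply: (strictly_decreasing_inj dec); rewrite ?perm_closed.
Qed.

End BlockMonomials.

Section PrescribedMonomials.

Variables (F : fieldType) (N m : nat).
Implicit Types (f : {mpoly F[N]}) (L kap : 'X_{1..N}) (T : symmetry_type) (s : 'S_N).

Definition antiI T := match T with AS | AA => true | SA | SS => false end.
Definition antiJ T := match T with AA | SA => true | AS | SS => false end.

Lemma prescribed_monomialE T L : prescribed_monomial F m T L =
  block_monomial F (antiI T) (blockI N m) L * block_monomial F (antiJ T) (blockJ N m) L.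
Proof. by case: T. Qed.

Lemma index_setP T L : index_set m T L <->
  (antiI T -> strictly_decreasing (blockI N m) L) /\
  (antiJ T -> strictly_decreasing (blockJ N m) L).
Proof.
case: T => /=; split=> //; try by [move=> [/(_ isT)] | move=> [_ /(_ isT)]].
- by case/andP.
- by case=> /(_ isT) -> /(_ isT) ->.
Qed.

Lemma setC_blockI : ~: blockI N m = blockJ N m.
Proof. by apply/setP => i; rewrite !inE -leqNgt. Qed.

Definition has_symmetry T f : Prop :=
  (forall s, perm_on (blockI N m) s -> msym s f = sgnb F (antiI T) s *: f) /\
  (forall s, perm_on (blockJ N m) s -> msym s f = sgnb F (antiJ T) s *: f).

Lemma prescribed_monomial_sym T L : has_symmetry T (prescribed_monomial F m T L).
Proof.
have dis := disjoint_blocks N m; have dis' := dis; rewrite disjoint_sym in dis'.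
split=> s sK; rewrite prescribed_monomialE msymM.
  rewrite (block_monomial_sym _ _ _ sK) (msym_fixed dis' _ sK) ?scalerAl //.
  by move=> kap i; apply: block_monomial_out.
rewrite (block_monomial_sym _ _ _ sK) (msym_fixed dis _ sK) ?scalerAr //.
by move=> kap i; apply: block_monomial_out.
Qed.

Lemma mcoeff_prescribed_monomial T L kap : (prescribed_monomial F m T L)@_kap =
  (block_monomial F (antiI T) (blockI N m) L)@_(restr (blockI N m) kap) *
  (block_monomial F (antiJ T) (blockJ N m) L)@_(restr (blockJ N m) kap).
Proof.
rewrite prescribed_monomialE -setC_blockI; apply: mcoeff_mul_blocks.
  by move=> nu i; apply: block_monomial_out.
move=> nu i /block_monomial_out H iI; apply: H; by rewrite inE iI.
Qed.

Lemma prescribed_monomial_supp T L kap :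
  (prescribed_monomial F m T L)@_kap != 0 -> super_equiv m kap L.
Proof.
rewrite mcoeff_prescribed_monomial mulf_eq0 negb_or => /andP[].
move=> /block_monomial_supp[s sI Es] /block_monomial_supp[t tJ Et].
suff -> : kap = [multinom [multinom L (s i) | i < N] (t i) | i < N].
  exact: super_equiv_blocks.
have dis := disjoint_blocks N m; have dis' := dis; rewrite disjoint_sym in dis'.
apply/mnmP => i; rewrite !mnmE; case: (boolP (i \in blockI N m)) => iI.
  have /mnmP/(_ i) := Es; rewrite !mnmE iI => ->.
  by rewrite (perm_on_fix dis tJ iI).
have iJ : i \in blockJ N m by rewrite -setC_blockI inE.
have /mnmP/(_ i) := Et; rewrite !mnmE iJ => ->.
by rewrite (perm_on_fix dis' sI) // perm_closed.
Qed.

Lemma prescribed_monomial_diag T L : index_set m T L ->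
  (prescribed_monomial F m T L)@_L = 1.
Proof.
by move/index_setP => [LI LJ]; rewrite mcoeff_prescribed_monomial !block_monomial_diag // mulr1.
Qed.

End PrescribedMonomials.

(** * Commutation of the Hamiltonians with permutations *)

Section Commutation.

Variables (F : fieldType) (alpha : F) (N : nat).
Implicit Types (f g : {mpoly F[N]}) (i j k l : 'I_N) (s t : 'S_N).

Local Notation K := (@exchange F N).
Local Notation xi := (@cherednik F N alpha).

Hypothesis alpha_gen :
  forall a b : nat, alpha * a%:R + b%:R = 0 -> a = 0%N /\ b = 0%N.

Lemma cherednikD j f g : xi j (f + g) = xi j f + xi j g.
Proof. by have := cherednik_linear alpha j 1 f g; rewrite !scale1r. Qed.

Lemma cherednikB j f g : xi j (f - g) = xi j f - xi j g.
Proof.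
rewrite [f - g]addrC [RHS]addrC.
by have := cherednik_linear alpha j (-1) g f; rewrite !scaleN1r.
Qed.

(** Passing the exchange through each square leaves a correction [xi k f + xi l f]; the two
    corrections have opposite signs. *)
Lemma ham_H_adjacent k l f : l = k.+1 :> nat ->
  ham_H alpha (K k l f) = K k l (ham_H alpha f).
Proof.
move=> kl; have nkl := adjacent_neq kl.
rewrite /ham_H [K k l (\sum_(i < N) _)]raddf_sum !(big_pair_split _ _ nkl) /= -!/(K k l _).
rewrite (eq_bigr (fun j => K k l (xi j (xi j f)))); last first.
  by move=> j /andP[jk jl]; rewrite !cherednik_exchange_other.
rewrite [LHS]addrA [RHS]addrA; congr (_ + _).
rewrite (cherednik_exchange alpha _ kl) (cherednik_exchange alpha f kl) cherednikD.
rewrite (cherednik_exchange_r alpha _ kl) (cherednik_exchange_r alpha f kl) cherednikB.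
by ring.
Qed.

Definition commutes_with (A : {mpoly F[N]} -> {mpoly F[N]}) s : Prop :=
  forall f, A (msym s f) = msym s (A f).

Lemma commutes_withM A s t :
  commutes_with A s -> commutes_with A t -> commutes_with A (s * t)%g.
Proof. by move=> cs ct f; rewrite !msymMm ct cs. Qed.

Lemma ham_H_tperm (d : nat) i j : (j = i + d.+1 :> nat)%N ->
  commutes_with (ham_H alpha) (tperm i j).
Proof.
elim: d i j => [|d IH] i j ij.
  by move=> f; apply: ham_H_adjacent; rewrite ij addn1.
have j'N : (i + d.+1 < N)%N by have := ltn_ord j; lia.
pose j' := Ordinal j'N.
have jj' : j = j'.+1 :> nat by rewrite /=; lia.
have adj : commutes_with (ham_H alpha) (tperm j' j).
  by move=> f; apply: ham_H_adjacent.
have -> : tperm i j = (tperm j' j * (tperm i j' * tperm j' j))%g.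
  have ni : tperm j' j i = i.
    by rewrite tpermD //; apply: gtn_ord_neq => /=; lia.
  rewrite -[X in (X * _)%g]tpermV -conjgE tpermJ ni tpermL //.
apply: commutes_withM => //; apply: commutes_withM => //.
exact: IH.
Qed.

Lemma ham_H_msym s f : ham_H alpha (msym s f) = msym s (ham_H alpha f).
Proof.
suff H : commutes_with (ham_H alpha) s by apply: H.
have [ts -> _] := prod_tpermP s; elim: ts => [|[i j] ts IH].
  by rewrite big_nil => g; rewrite !msym1m.
rewrite big_cons /=; apply: commutes_withM => //.
case: (ltngtP i j) => ij.
- by apply: (@ham_H_tperm (j - i.+1)); lia.
- by rewrite tpermC; apply: (@ham_H_tperm (i - j.+1)); lia.
- by move=> g; rewrite (val_inj ij) tperm1 !msym1m.
Qed.

Lemma mpoly_double_inj : injective (fun f => f + f).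
Proof.
move=> f g /= E; have two : (2%:R : F) != 0 by apply: (natF_neq0 alpha_gen 1).
have dbl h : h + h = 2%:R *: h by rewrite scaler_nat mulr2n.
move: E; rewrite !dbl => /(congr1 (fun h => (2%:R : F)^-1 *: h)).
by rewrite !scalerA mulVf // !scale1r.
Qed.

(** The Dunkl part is equivariant. The exchange part runs over pairs [i < j], which [s] does not
    respect, but its double runs over all ordered pairs of distinct positions of the first block and
    is visibly invariant; characteristic zero allows dividing by two. *)
Lemma ham_I_msym m s f : (forall i, (s i < m)%N = (i < m)%N) ->
  ham_I alpha m (msym s f) = msym s (ham_I alpha m f).
Proof.
move=> sm; pose S g := \sum_(j < N | (j < m)%N) \sum_(i < N | (i < j)%N) K i j g.
have hamE g : ham_I alpha m g = \sum_(j < N | (j < m)%N) dunkl alpha j g - S g.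
  by rewrite /ham_I -sumrB; apply: eq_bigr => j _; apply: cherednikE.
rewrite !hamE msymB; congr (_ - _).
  rewrite raddf_sum (reindex_inj (@perm_inj _ s)) /=.
  by apply: eq_big => [j|j _]; rewrite ?sm ?msym_dunkl.
have SS g : S g + S g =
    \sum_(j < N | (j < m)%N) \sum_(i < N | (i < m)%N && (i != j)) K i j g.
  rewrite {2}/S (exchange_big_dep (fun i : 'I_N => (i < m)%N)) /=; last first.
    by move=> j i jm ij; apply: ltn_trans jm.
  rewrite /S -big_split; apply: eq_bigr => j jm /=.
  rewrite [RHS](bigID (fun i : 'I_N => (i < j)%N)) /=; congr (_ + _).
    apply: eq_bigl => i; case: (ltnP i j) => [ij|]; rewrite ?andbF //.
    by rewrite (ltn_trans ij jm) (ltn_ord_neq ij).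
  apply: eq_big => [i|i _]; last exact: exchangeC.
  by rewrite -leqNgt -andbA [(j < i)%N]ltn_neqAle eq_sym.
apply: mpoly_double_inj; rewrite -[in RHS]msymD !SS.
rewrite raddf_sum (reindex_inj (@perm_inj _ s)) /=.
apply: eq_big => [j|j _]; first by rewrite sm.
rewrite raddf_sum (reindex_inj (@perm_inj _ s)) /=.
apply: eq_big => [i|i _]; first by rewrite sm (inj_eq perm_inj).
exact: exchange_msym.
Qed.

End Commutation.

(** * Symmetrization and expansion in monomials of prescribed symmetry *)

Section Symmetrization.

Variables (F : fieldType) (N m : nat).
Implicit Types (f g : {mpoly F[N]}) (b : bool) (s t : 'S_N) (A : {set 'I_N}).

Definition symz b A f : {mpoly F[N]} :=
  \sum_(s : 'S_N | perm_on A s) sgnb F b s *: msym s f.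

Lemma prescribed_symmetrizationE T f : prescribed_symmetrization m T f =
  symz (antiI T) (blockI N m) (symz (antiJ T) (blockJ N m) f).
Proof.
have SymE A g : Defs.Sym A g = symz false A g by apply: eq_bigr => s _; rewrite scale1r.
by case: T => /=; rewrite ?SymE.
Qed.

Lemma symz_sym b A t f : perm_on A t -> msym t (symz b A f) = sgnb F b t *: symz b A f.
Proof.
move=> tA; rewrite raddf_sum scaler_sumr [RHS](reindex_inj (mulIg t)) /=.
apply: eq_big => [s|s _]; first by rewrite perm_on_mulr.
by rewrite msymZ -msymMm scalerA sgnbM mulrCA sgnb_sqr mulr1.
Qed.

Lemma symz_disjoint b A A' t f : [disjoint A & A'] -> perm_on A' t ->
  msym t (symz b A f) = symz b A (msym t f).
Proof.
move=> dis tA'; rewrite raddf_sum; apply: eq_bigr => s sA /=.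
by rewrite msymZ -!msymMm (perm_onC sA tA' dis).
Qed.

Lemma symzZ b A c f : symz b A (c *: f) = c *: symz b A f.
Proof.
rewrite /symz scaler_sumr; apply: eq_bigr => s _.
by rewrite msymZ !scalerA mulrC.
Qed.

Lemma prescribed_symmetrization_sym T f :
  has_symmetry m T (prescribed_symmetrization m T f).
Proof.
rewrite prescribed_symmetrizationE; split=> s sA; first exact: symz_sym.
by rewrite (symz_disjoint _ _ (disjoint_blocks N m) sA) symz_sym // symzZ.
Qed.

Lemma symz_commute b A (B : {mpoly F[N]} -> {mpoly F[N]}) f : linear B ->
  (forall s g, perm_on A s -> B (msym s g) = msym s (B g)) ->
  B (symz b A f) = symz b A (B f).
Proof.
move=> linB comm; have B0 : B 0 = 0.
  by have := linB (-1) 0 0; rewrite scaler0 addr0 scaleN1r addNr.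
rewrite /symz; elim/big_rec2: _ => // s g h sA <-.
by rewrite linB comm.
Qed.

Lemma mcoeff_prescribed_symmetrization T f nu :
  (prescribed_symmetrization m T f)@_nu =
  \sum_(s : 'S_N | perm_on (blockI N m) s) \sum_(t : 'S_N | perm_on (blockJ N m) t)
    sgnb F (antiI T) s * sgnb F (antiJ T) t *
    f@_[multinom [multinom nu (s i) | i < N] (t i) | i < N].
Proof.
rewrite prescribed_symmetrizationE raddf_sum; apply: eq_bigr => s _ /=.
rewrite mcoeffZ mcoeff_sym raddf_sum mulr_sumr; apply: eq_bigr => t _ /=.
by rewrite mcoeffZ mcoeff_sym mulrA.
Qed.

Hypothesis two_neq0 : (2%:R : F) != 0.

Lemma has_symmetry_swap T f i j (eps := fun b : bool => if b then -1 else 1 : F) :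
  has_symmetry m T f -> i != j ->
  (i \in blockI N m -> j \in blockI N m -> forall nu,
     f@_(swap_mnm nu i j) = eps (antiI T) * f@_nu) /\
  (i \in blockJ N m -> j \in blockJ N m -> forall nu,
     f@_(swap_mnm nu i j) = eps (antiJ T) * f@_nu).
Proof.
move=> [symI symJ] ij.
have on A : i \in A -> j \in A -> perm_on A (tperm i j).
  move=> iA jA; apply/subsetP => k; rewrite inE.
  by case: tpermP => [->|->|_ _]; rewrite ?eqxx.
have sgn b : sgnb F b (tperm i j) = eps b.
  by case: b; rewrite /sgnb // odd_tperm ij expr1.
split=> iA jA nu; rewrite -mcoeff_sym.
  by rewrite symI ?on // mcoeffZ sgn.
by rewrite symJ ?on // mcoeffZ sgn.
Qed.

(** A Bruhat-maximal monomial of a nonzero [f] must be an admissible superpartition: an ascent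
    inside a block could be exchanged for a higher monomial, and equal parts in an antisymmetric
    block make a coefficient equal to its opposite. *)
Lemma has_symmetry_eq0 n T f : has_symmetry m T f ->
  (forall nu, f@_nu != 0 -> mdeg nu = n) ->
  (forall L, superpartition m n L -> index_set m T L -> f@_L = 0) -> f = 0.
Proof.
move=> symf homf f0; apply/eqP; rewrite -msupp_eq0; apply/eqP.
case E : (msupp f) => [//|kap0 r]; exfalso.
have : kap0 \in msupp f by rewrite E inE eqxx.
case/bruhat_maximal => L [Lf _ maxL].
have fL : f@_L != 0 by rewrite -mcoeff_msupp.
have nosign (x : F) : x = -1 * x -> x = 0.
  rewrite mulN1r => /eqP; rewrite -addr_eq0 -mulr2n -mulr_natl mulf_eq0.
  by rewrite (negbTE two_neq0) => /eqP.
have same_block i j b : i != j ->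
    (forall nu, f@_(swap_mnm nu i j) = (if b then -1 else 1) * f@_nu) ->
    (i < j)%N -> ((L j <= L i) && (b ==> (L j < L i)))%N.
  move=> ij sw lt; case: (ltngtP (L i) (L j)) => [Lij|Lij|Lij].
  - exfalso; have bru : bruhat_le L (swap_mnm L i j).
      apply: (bruhat_pair lt); rewrite ?swap_p ?swap_q ?(addnC (L j)) //.
        by move=> k ki kj; rewrite swap_other.
      by right; split; rewrite // ltnW.
    have supp_sw : swap_mnm L i j \in msupp f.
      rewrite mcoeff_msupp sw mulf_neq0 //; case: (b); by rewrite ?oppr_eq0 oner_eq0.
    have /mnmP/(_ i) := maxL _ supp_sw bru; rewrite swap_p.
    by move/eqP; rewrite gtn_eqF.
  - by rewrite implybT.
  - case: b sw => //= sw; case/eqP: fL; apply: nosign; rewrite -sw; congr (f@__).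
    by apply/mnmP => k; rewrite mnmE; case: tpermP => // ->.
have blkI i j : i \in blockI N m -> j \in blockI N m -> (i < j)%N ->
    ((L j <= L i) && (antiI T ==> (L j < L i)))%N.
  move=> iI jI ij; have ne := ltn_ord_neq ij.
  apply: same_block => // nu; exact: (has_symmetry_swap symf ne).1.
have blkJ i j : i \in blockJ N m -> j \in blockJ N m -> (i < j)%N ->
    ((L j <= L i) && (antiJ T ==> (L j < L i)))%N.
  move=> iJ jJ ij; have ne := ltn_ord_neq ij.
  apply: same_block => // nu; exact: (has_symmetry_swap symf ne).2.
case/eqP: fL; apply: f0.
  apply/and3P; split; last by rewrite homf // -mcoeff_msupp.
  - by apply/weakly_decreasingP => i j iI jI /(blkI _ _ iI jI) /andP[].
  - by apply/weakly_decreasingP => i j iI jI /(blkJ _ _ iI jI) /andP[].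
apply/index_setP; split=> anti; apply/strictly_decreasingP => i j iI jI.
  by move/(blkI _ _ iI jI) => /andP[_]; rewrite anti.
by move/(blkJ _ _ iI jI) => /andP[_]; rewrite anti.
Qed.

(** Distinct superpartitions have disjoint orbits, so the difference of the two sides has zero
    coefficient at every admissible superpartition, and [has_symmetry_eq0] applies to it. *)
Lemma has_symmetry_expansion n T f : has_symmetry m T f ->
  (forall nu, f@_nu != 0 -> mdeg nu = n) ->
  f = \sum_(G : 'X_{1..N < n.+1} | superpartition m n G && index_set m T G)
        f@_G *: prescribed_monomial F m T G.
Proof.
move=> symf homf; apply/eqP; rewrite -subr_eq0; apply/eqP.
apply: (@has_symmetry_eq0 n T).
- have [sI sJ] := symf.
  split=> s sA; rewrite msymB scalerBr.
    rewrite sI //; congr (_ - _); rewrite raddf_sum scaler_sumr; apply: eq_bigr => G _ /=.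
    by rewrite msymZ (prescribed_monomial_sym F m T G).1 // !scalerA mulrC.
  rewrite sJ //; congr (_ - _); rewrite raddf_sum scaler_sumr; apply: eq_bigr => G _ /=.
  by rewrite msymZ (prescribed_monomial_sym F m T G).2 // !scalerA mulrC.
- move=> nu; case: (eqVneq f@_nu 0) => [f0|/homf //].
  rewrite mcoeffB f0 add0r oppr_eq0 raddf_sum /= => ne.
  have [G /andP[/and3P[_ _ /eqP degG] _] Gnu] : exists2 G : 'X_{1..N < n.+1},
      superpartition m n G && index_set m T G & (prescribed_monomial F m T G)@_nu != 0.
    apply/exists_inP; apply: contraNT ne => /exists_inPn none.
    rewrite big1 // => G /none; rewrite negbK mcoeffZ => /eqP ->.
    by rewrite mulr0.
  by rewrite -[RHS]degG; apply: super_equiv_mdeg (prescribed_monomial_supp Gnu).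
move=> L spL idxL; rewrite mcoeffB raddf_sum /=.
have LB : (mdeg L < n.+1)%N by case/and3P: spL => _ _ /eqP ->.
rewrite (bigD1 (BMultinom LB)) /=; last by rewrite spL.
rewrite mcoeffZ prescribed_monomial_diag // mulr1 big1 ?addr0 ?subrr //.
move=> G /andP[/andP[spG _] GL]; rewrite mcoeffZ.
case: (eqVneq (prescribed_monomial F m T G)@_L 0) => [->|]; first by rewrite mulr0.
move/prescribed_monomial_supp/(superpartition_inj spL spG) => E.
by case/eqP: GL; apply: val_inj.
Qed.

End Symmetrization.

(** * Uniqueness and existence *)

(** For formal [alpha] the coefficients of a polynomial of degree at most one are compared. For
    complex [alpha], a relation with positive [a] gives [alpha = - b / a], which is zero or a
    negative rational. *)
Lemma generic_nat (R : realType) (F : fieldType) (alpha : F) : generic R alpha ->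
  forall a b : nat, alpha * a%:R + b%:R = 0 -> a = 0%N /\ b = 0%N.
Proof.
case=> [|z z0 zneg] a b E.
  have natC k : (k%:R : {poly R[i]})%R = k%:R%:P by rewrite polyC_natr.
  have : 'X * a%:R%:P + b%:R%:P = 0 :> {poly R[i]}.
    by apply/eqP; rewrite -tofrac_eq0 rmorphD rmorphM /= -!natC !rmorph_nat E.
  move/polyP => Ep; have := Ep 0%N; have := Ep 1%N.
  rewrite !coefD !coefXM !coefC /= addr0 add0r => /eqP + /eqP.
  by rewrite !Num.Theory.pnatr_eq0 => /eqP -> /eqP ->.
case: a E => [|a] E.
  by move/eqP: E; rewrite mulr0 add0r Num.Theory.pnatr_eq0 => /eqP ->.
exfalso; have a0 : (a.+1%:R : R[i]) != 0 by rewrite Num.Theory.pnatr_eq0.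
have zE : z = - (b%:R / a.+1%:R).
  apply: (mulIf a0); rewrite mulNr mulfVK //.
  by apply/eqP; rewrite -addr_eq0 E.
case: b E zE => [|b] E zE; first by move: z0; rewrite zE mul0r oppr0 eqxx.
have /zneg/eqP : (- (b.+1%:R / a.+1%:R) < 0 :> rat)%R.
  by rewrite Num.Theory.oppr_lt0 Num.Theory.divr_gt0 // Num.Theory.ltr0n.
by case; rewrite zE rmorphN fmorph_div !rmorph_nat.
Qed.

Section Uniqueness.

Variables (F : fieldType) (alpha : F) (N m n : nat) (T : symmetry_type) (L : 'X_{1..N}).
Implicit Types (P Q f : {mpoly F[N]}) (nu : 'X_{1..N}).

Hypothesis alpha_gen :
  forall a b : nat, alpha * a%:R + b%:R = 0 -> a = 0%N /\ b = 0%N.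

Lemma eigen_d_equiv nu : super_equiv m nu L -> eigen_d alpha nu = eigen_d alpha L.
Proof. by case=> E _; rewrite /eigen_d; have /sp_star_eqP -> := E. Qed.

Lemma eigen_e_equiv nu : super_equiv m nu L -> eigen_e alpha m nu = eigen_e alpha m L.
Proof.
case=> E h; rewrite /eigen_e; have /sp_star_eqP -> := E.
by have /(sp_circ_eqP m E) -> := h.
Qed.

(** If the starred partitions differ, they have equal size, so [eigen_d] separates their content
    sums. If they agree, [eigen_e] is the content sum of the circled partition up to a common
    constant. *)
Lemma sp_gt_separated nu : sp_gt m L nu ->
  eigen_d alpha nu = eigen_d alpha L -> eigen_e alpha m nu = eigen_e alpha m L -> False.
Proof.
case/orP => [gt Ed _|/andP[/eqP star_eq gt] _ Ee].
  apply: (content_sum_gt alpha_gen _ _ _ gt); rewrite ?sorted_rearr ?size_sp_star //.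
  move: Ed; rewrite /eigen_d !part_eps_content.
  have /andP[_ /andP[/eqP -> _]] := gt; move/addIr/addIr/mulfI => -> //.
  by rewrite mulf_neq0 ?(alpha_neq0 alpha_gen) // (natF_neq0 alpha_gen).
apply: (content_sum_gt alpha_gen _ _ _ gt); rewrite ?sorted_rearr ?size_sp_circ //.
by move: Ee; rewrite !eigen_e_content star_eq => /addIr.
Qed.

Lemma sp_gt_irr : sp_gt m L L = false.
Proof. by apply/negP => /sp_gtP[le []]. Qed.

Lemma sp_gt_equiv nu nu' : super_equiv m nu nu' -> sp_gt m L nu' -> sp_gt m L nu.
Proof.
move=> E /sp_gtP[le nle]; have E' := super_equiv_sym E.
have LL : super_equiv m L L by [].
apply/sp_gtP; split; first exact: super_le_equiv E' LL le.
by move=> le'; apply: nle; apply: super_le_equiv LL E le'.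
Qed.

Lemma propB1_mcoeff P nu : propB1 m n T L P -> ~~ sp_gt m L nu ->
  P@_nu = (prescribed_monomial F m T L)@_nu.
Proof.
move=> [c ->] ngt; rewrite mcoeffD raddf_sum big1 ?addr0 //= => G /and3P[_ _ gt].
rewrite mcoeffZ; case: (eqVneq (prescribed_monomial F m T G)@_nu 0) => [->|].
  by rewrite mulr0.
by move/prescribed_monomial_supp => E; rewrite (sp_gt_equiv E gt) in ngt.
Qed.

Lemma eigen_maximal P nu d e : nu \in msupp P ->
  (forall kap, kap \in msupp P -> bruhat_le nu kap -> kap = nu) ->
  ham_H alpha P = d *: P -> ham_I alpha m P = e *: P ->
  d = eigen_d alpha nu /\ e = eigen_e alpha m nu.
Proof.
rewrite mcoeff_msupp => nuP max_nu dP eP.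
have := triangular_mcoeff (triangular_ham_H _ alpha_gen) max_nu.
have := triangular_mcoeff (triangular_ham_I alpha _ m) max_nu.
by rewrite dP eP !mcoeffZ => /(mulIf nuP) -> /(mulIf nuP) ->.
Qed.

Hypothesis L_idx : index_set m T L.

(** The eigenvalues in [propB2] are left free. A maximal monomial above [L] cannot belong to a
    strictly smaller superpartition, so it comes from the monomial of [L], and its eigenvalues are
    those of [L]. *)
Lemma propB2_eigenvalues P d e : propB1 m n T L P ->
  ham_H alpha P = d *: P -> ham_I alpha m P = e *: P ->
  d = eigen_d alpha L /\ e = eigen_e alpha m L.
Proof.
move=> B1 dP eP.
have PL : P@_L = 1.
  by rewrite (propB1_mcoeff B1) ?sp_gt_irr // prescribed_monomial_diag.
have : L \in msupp P by rewrite mcoeff_msupp PL oner_eq0.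
case/bruhat_maximal => nu [nuP Lnu max_nu].
have [-> ->] := eigen_maximal nuP max_nu dP eP.
suff E : super_equiv m nu L by rewrite eigen_d_equiv // eigen_e_equiv.
have nle := bruhat_super m Lnu.
case: (boolP (sp_gt m L nu)) => [/sp_gtP[]//|ngt].
by apply: (@prescribed_monomial_supp F _ _ T); rewrite -(propB1_mcoeff B1 ngt) -mcoeff_msupp.
Qed.

(** Both polynomials have the eigenvalues of [L], and their difference lives on strictly smaller
    superpartitions, whose eigenvalues are different. *)
Lemma prescribed_unique P Q : propB1 m n T L P -> propB2 alpha m P ->
  propB1 m n T L Q -> propB2 alpha m Q -> P = Q.
Proof.
move=> P1 [d [e [dP eP]]] Q1 [d' [e' [dQ eQ]]].
have [dE eE] := propB2_eigenvalues P1 dP eP.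
have [dE' eE'] := propB2_eigenvalues Q1 dQ eQ.
rewrite {}dE {}eE in dP eP; rewrite {}dE' {}eE' in dQ eQ.
apply/eqP; rewrite -subr_eq0 -msupp_eq0; apply/eqP.
case E : (msupp (P - Q)) => [//|kap r]; exfalso.
have : kap \in msupp (P - Q) by rewrite E inE eqxx.
case/bruhat_maximal => nu [nuR _ max_nu].
have linB (A : {mpoly F[N]} -> {mpoly F[N]}) c : linear A ->
    A P = c *: P -> A Q = c *: Q -> A (P - Q) = c *: (P - Q).
  move=> linA AP AQ; rewrite [P - Q]addrC; have := linA (-1) Q P.
  by rewrite AP AQ !scaleN1r => ->; rewrite scalerDr scalerN.
have dR := linB _ _ (triangular_ham_H _ alpha_gen).1 dP dQ.
have eR := linB _ _ (triangular_ham_I alpha _ m).1 eP eQ.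
have [dE eE] := eigen_maximal nuR max_nu dR eR.
apply: (@sp_gt_separated nu) => //; apply: contraLR nuR => ngt.
rewrite mcoeff_msupp negbK mcoeffB.
by rewrite (propB1_mcoeff P1 ngt) (propB1_mcoeff Q1 ngt) subrr.
Qed.

End Uniqueness.

(** * The Jack polynomial satisfies both properties *)

Section Existence.

Variables (F : fieldType) (alpha : F) (N : nat).
Implicit Types (f : {mpoly F[N]}) (eta nu L : 'X_{1..N}).

Hypothesis alpha_gen :
  forall a b : nat, alpha * a%:R + b%:R = 0 -> a = 0%N /\ b = 0%N.

Lemma linear_scale (A : {mpoly F[N]} -> {mpoly F[N]}) c f :
  linear A -> A (c *: f) = c *: A f.
Proof.
move=> linA; have A0 : A 0 = 0.
  by have := linA (-1) 0 0; rewrite scaler0 addr0 scaleN1r addNr.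
by rewrite -[c *: f]addr0 linA A0 addr0.
Qed.

Lemma is_nsJack_leads eta f :
  leads eta 1 f -> (forall j, cherednik alpha j f = eta_bar alpha eta j *: f) ->
  is_nsJack alpha eta f.
Proof.
move=> [f1 supp_f] eig; split=> //; exists (fun nu => f@_nu).
have etaB : (mdeg eta < (mdeg eta).+1)%N by [].
rewrite {1}(@mpolywE _ _ (mdeg eta).+1 f); last first.
  rewrite msizeE; apply/bigmax_leqP_seq => nu; rewrite mcoeff_msupp => /supp_f[-> _ _] _.
  exact: leqnn.
rewrite (bigD1 (BMultinom etaB)) //= f1 scale1r; congr (_ + _).
rewrite (bigID (fun nu : 'X_{1..N < (mdeg eta).+1} => comp_gt eta nu)) /=.
rewrite [X in _ + X]big1 ?addr0 => [|nu /andP[ne ngt]].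
  apply: eq_bigl => nu; rewrite andbC; case: (boolP (comp_gt eta nu)) => //= gt.
  by apply: contraTneq gt => ->; rewrite /comp_gt !eqxx.
case: (eqVneq f@_nu 0) => [->|/supp_f le]; first by rewrite scale0r.
by rewrite bruhat_comp_gt in ngt.
Qed.

(** The constructed eigenvector, normalized, shows that the choice made by [nsJack] is a genuine
    solution. That choice is a priori triangular for [comp_gt] only; its eigenvalue equations
    improve this to [bruhat_le]. *)
Lemma nsJackP eta : (0 < N)%N ->
  leads eta 1 (nsJack alpha eta) /\
  forall j, cherednik alpha j (nsJack alpha eta) = eta_bar alpha eta j *: nsJack alpha eta.
Proof.
move=> N_gt0; have ex : exists f, is_nsJack alpha eta f.
  have [f [f0 eig]] : exists f, joint_eigenvector alpha eta f.
    by case: N N_gt0 eta => // n' _ eta'; apply: joint_eigenvector_exists.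
  have [fe lead_f] := joint_eigenvector_leads alpha_gen f0 eig.
  exists ((f@_eta)^-1 *: f); apply: is_nsJack_leads.
    by rewrite -(mulVf fe); apply: leadsZ.
  move=> j; rewrite (linear_scale _ _ (cherednik_linear alpha j)) eig !scalerA.
  by rewrite mulrC.
have : is_nsJack alpha eta (nsJack alpha eta).
  by rewrite /nsJack; case: classical_sets.xgetP => // none; case: ex => f /none.
move: (nsJack alpha eta) => E [[c defE] eig].
have E1 : E@_eta = 1.
  rewrite defE mcoeffD mcoeffX eqxx raddf_sum big1 ?addr0 // => nu gt /=.
  rewrite mcoeffZ mcoeffX; case: eqP => [nuE|_]; last by rewrite mulr0.
  by move: gt; rewrite nuE /comp_gt !eqxx.
split=> //; have E0 : E != 0.
  by apply/eqP => Ez; move/eqP: E1; rewrite Ez mcoeff0 eq_sym oner_eq0.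
by have [_] := joint_eigenvector_leads alpha_gen E0 eig; rewrite E1.
Qed.

Variables (m n : nat) (T : symmetry_type) (L : 'X_{1..N}).

Hypotheses (N_gt0 : (0 < N)%N) (mN : (m <= N)%N).
Hypotheses (L_sp : superpartition m n L) (L_idx : index_set m T L).

Local Notation E := (nsJack alpha (eta_of m L)).
Local Notation f := (prescribed_symmetrization m T E).

Lemma symmetrization_supp nu : f@_nu != 0 -> super_le m nu L.
Proof.
rewrite mcoeff_prescribed_symmetrization => ne.
have [s sI [t tJ Est]] : exists2 s : 'S_N, perm_on (blockI N m) s &
    exists2 t : 'S_N, perm_on (blockJ N m) t &
    E@_[multinom [multinom nu (s i) | i < N] (t i) | i < N] != 0.
  apply: boolp.contrapT => none; case/eqP: ne; apply: big1 => s sI; apply: big1 => t tJ.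
  apply/eqP; rewrite mulf_eq0; apply/orP; right; apply/negPn/negP => Est.
  by apply: none; exists s => //; exists t.
have [[_ supp_E] _] := nsJackP (eta_of m L) N_gt0.
apply: super_le_equiv (bruhat_super m (supp_E _ Est)).
  exact: super_equiv_blocks.
exact: eta_of_equiv.
Qed.

Lemma symmetrization_mcoeff_neq0 : f@_L != 0.
Proof.
have [[E1 supp_E] _] := nsJackP (eta_of m L) N_gt0.
have [incI incJ] : weakly_increasing (blockI N m) (eta_of m L) /\
    weakly_increasing (blockJ N m) (eta_of m L).
  by case/and3P: L_sp => dI dJ _; split;
    [exact: eta_of_increasingI | exact: eta_of_increasingJ].
pose hit (s t : 'S_N) :=
  [multinom [multinom L (s i) | i < N] (t i) | i < N] == eta_of m L.
have dis := disjoint_blocks N m; have dis' := dis; rewrite disjoint_sym in dis'.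
have [strI strJ] := (index_setP m T L).1 L_idx.
rewrite mcoeff_prescribed_symmetrization.
have termE s t : perm_on (blockI N m) s -> perm_on (blockJ N m) t ->
    sgnb F (antiI T) s * sgnb F (antiJ T) t *
    E@_[multinom [multinom L (s i) | i < N] (t i) | i < N] =
    sgnb F (antiI T) (revI mN) * sgnb F (antiJ T) (revJ mN) * (hit s t)%:R.
  move=> sI tJ; rewrite /hit; case: eqP => [st|ne]; last first.
    rewrite mulr0; apply/eqP; rewrite mulf_eq0; apply/orP; right.
    apply/negPn/negP => /supp_E le; apply: ne; apply: bruhat_anti le _.
    (* The permuted exponent is in the orbit whose minimum is [eta_of m L], and in the support below
       that minimum, so it equals it. *)
    apply: (@bruhat_min _ m) => //; apply: super_equiv_trans (super_equiv_blocks L sI tJ) _.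
    exact/super_equiv_sym/eta_of_equiv.
  (* In an antisymmetric block the parts are distinct, so the permutation producing [eta_of m L] is
     unique there: every surviving term carries the sign of the block reversal. *)
  rewrite st E1; congr (_ * _ * _).
    case: (antiI T) strI => // /(_ isT) str; congr (sgnb F _ _); apply/permP => i.
    case: (boolP (i \in blockI N m)) => iI; last first.
      by rewrite (out_perm sI) // (out_perm (revI_on mN)).
    move: st; rewrite (eta_ofE mN) => /mnmP/(_ i); rewrite !mnmE.
    rewrite (perm_on_fix dis tJ iI) (perm_on_fix dis (revJ_on mN) iI).
    by apply: strictly_decreasing_inj str _ _; rewrite perm_closed // revI_on.
  case: (antiJ T) strJ => // /(_ isT) str; congr (sgnb F _ _); apply/permP => i.
  case: (boolP (i \in blockJ N m)) => iJ; last first.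
    by rewrite (out_perm tJ) // (out_perm (revJ_on mN)).
  have tiJ : t i \in blockJ N m by rewrite perm_closed.
  have riJ : revJ mN i \in blockJ N m by rewrite perm_closed // revJ_on.
  move: st; rewrite (eta_ofE mN) => /mnmP/(_ i); rewrite !mnmE.
  rewrite (perm_on_fix dis' sI tiJ) (perm_on_fix dis' (revI_on mN) riJ).
  exact: strictly_decreasing_inj str _ _.
have -> : \sum_(s : 'S_N | perm_on (blockI N m) s)
    \sum_(t : 'S_N | perm_on (blockJ N m) t)
      sgnb F (antiI T) s * sgnb F (antiJ T) t *
      E@_[multinom [multinom L (s i) | i < N] (t i) | i < N] =
    sgnb F (antiI T) (revI mN) * sgnb F (antiJ T) (revJ mN) *
    (\sum_(s : 'S_N | perm_on (blockI N m) s)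
       \sum_(t : 'S_N | perm_on (blockJ N m) t) hit s t)%:R.
  rewrite natr_sum mulr_sumr; apply: eq_bigr => s sI.
  by rewrite natr_sum mulr_sumr; apply: eq_bigr => t tJ; apply: termE.
rewrite !mulf_neq0 ?sgnb_neq0 //; apply/eqP => /(natF_eq0 alpha_gen) /eqP.
(* The pair of block reversals is counted, so the number of hits is positive. *)
rewrite (bigD1 (revI mN)) ?revI_on //= addn_eq0 => /andP[+ _].
by rewrite (bigD1 (revJ mN)) ?revJ_on //= /hit -eta_ofE eqxx.
Qed.

Local Notation P := (Jack_prescribed alpha m T L).

Lemma Jack_prescribedE : P = (f@_L)^-1 *: f.
Proof. by []. Qed.

Lemma Jack_supp nu : P@_nu != 0 -> super_le m nu L.
Proof.
by rewrite Jack_prescribedE mcoeffZ mulf_eq0 negb_or => /andP[_ /symmetrization_supp].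
Qed.

Lemma Jack_mcoeff : P@_L = 1.
Proof. by rewrite Jack_prescribedE mcoeffZ mulVf // symmetrization_mcoeff_neq0. Qed.

Lemma Jack_symmetry : has_symmetry m T P.
Proof.
have [sI sJ] := prescribed_symmetrization_sym m T E.
split=> s sA; rewrite Jack_prescribedE msymZ.
  by rewrite sI // !scalerA mulrC.
by rewrite sJ // !scalerA mulrC.
Qed.

Lemma Jack_propB1 : propB1 m n T L P.
Proof.
have homP nu : P@_nu != 0 -> mdeg nu = n.
  by case/Jack_supp => -> _ _; case/and3P: L_sp => _ _ /eqP.
exists (fun nu => P@_nu).
have two : (2%:R : F) != 0 by apply: (natF_neq0 alpha_gen 1).
rewrite {1}(has_symmetry_expansion two Jack_symmetry homP).
have LB : (mdeg L < n.+1)%N by case/and3P: L_sp => _ _ /eqP ->.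
rewrite (bigD1 (BMultinom LB)) /= ?L_sp // Jack_mcoeff scale1r; congr (_ + _).
rewrite (bigID (fun G : 'X_{1..N < n.+1} => sp_gt m L G)) /=.
rewrite [X in _ + X]big1 ?addr0 => [|G /andP[/andP[/andP[spG _] GL] ngt]].
  apply: eq_bigl => G; case: (superpartition m n G) => //.
  case: (index_set m T G) => //=; rewrite andbC; case: (boolP (sp_gt m L G)) => //= gt.
  by apply: contraTneq gt => ->; rewrite sp_gt_irr.
case: (eqVneq P@_G 0) => [->|/Jack_supp le]; first by rewrite scale0r.
(* Below [L] without being strictly below means equivalent to [L], and equivalent superpartitions
   coincide. *)
case/eqP: GL; apply: val_inj; apply: (superpartition_inj spG L_sp).
apply: (super_le_anti le); apply: boolp.contrapT => nle.
by case/negP: ngt; apply/sp_gtP.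
Qed.

Lemma Jack_ham_H : ham_H alpha P = eigen_d alpha L *: P.
Proof.
have linH := (triangular_ham_H N alpha_gen).1; have [_ eig] := nsJackP (eta_of m L) N_gt0.
rewrite Jack_prescribedE (linear_scale _ _ linH) prescribed_symmetrizationE.
rewrite !(symz_commute _ _ linH) => [|s g _|s g _]; try exact: ham_H_msym.
have -> : ham_H alpha E = eigen_d alpha L *: E.
  rewrite -(eigen_d_equiv alpha (eta_of_equiv mN L)) (eigen_dE alpha_gen) scaler_suml.
  apply: eq_bigr => j _.
  by rewrite eig (linear_scale _ _ (cherednik_linear alpha j)) eig scalerA expr2.
by rewrite !symzZ !scalerA mulrC.
Qed.

Lemma Jack_ham_I : ham_I alpha m P = eigen_e alpha m L *: P.
Proof.
have linI := (triangular_ham_I alpha N m).1; have [_ eig] := nsJackP (eta_of m L) N_gt0.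
rewrite Jack_prescribedE (linear_scale _ _ linI) prescribed_symmetrizationE.
rewrite (symz_commute _ _ linI) => [|s g sI]; last first.
  by apply: ham_I_msym => // i; apply: perm_blockI.
rewrite (symz_commute _ _ linI) => [|s g sJ]; last first.
  by apply: ham_I_msym => // i; apply: perm_blockJ.
have -> : ham_I alpha m E = eigen_e alpha m L *: E.
  rewrite -(eigen_e_equiv alpha (eta_of_equiv mN L)) eigen_eE scaler_suml.
  by apply: eq_bigr => j _; apply: eig.
by rewrite !symzZ !scalerA mulrC.
Qed.

End Existence.

Theorem mainTheorem1 (R : realType) (F : fieldType) (alpha : F)
    (N m n : nat) (T : symmetry_type) (L : 'X_{1..N}) :
  generic R alpha ->
  (1 <= N)%N -> (m <= N)%N ->
  superpartition m n L -> index_set m T L ->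
  unique (fun P : {mpoly F[N]} => propB1 m n T L P /\ propB2 alpha m P)
         (Jack_prescribed alpha m T L)
  /\ ham_H alpha (Jack_prescribed alpha m T L)
       = eigen_d alpha L *: Jack_prescribed alpha m T L
  /\ ham_I alpha m (Jack_prescribed alpha m T L)
       = eigen_e alpha m L *: Jack_prescribed alpha m T L.
Proof.
move=> /generic_nat alpha_gen N_gt0 mN L_sp L_idx.
have dP := Jack_ham_H alpha_gen T L N_gt0 mN.
have eP := Jack_ham_I alpha_gen T L N_gt0 mN.
have B1 := Jack_propB1 alpha_gen N_gt0 mN L_sp L_idx.
have B2 : propB2 alpha m (Jack_prescribed alpha m T L).
  by exists (eigen_d alpha L), (eigen_e alpha m L).
split=> //; split=> // Q [Q1 Q2].
exact: (prescribed_unique alpha_gen L_idx B1 B2 Q1 Q2).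
Qed.
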